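(* For any state $\rho$ on a finite-dimensional Hilbert space with a fixed incoherent basis, $$C_a^{\infty}(\rho)=D_a^{\infty}(\rho).$$
   Context: All Hilbert spaces are finite-dimensional and each carries a fixed orthonormal ''incoherent'' basis $\{|i\rangle\}$; $\mathcal H^{\otimes n}$ carries the product basis. For a unit vector $|\psi\rangle$ write $\psi=|\psi\rangle\langle\psi|$. A state is incoherent if it is diagonal in the fixed basis. $\Delta$ is the dephasing map $\Delta(X)=\sum_i |i\rangle\langle i|X|i\rangle\langle i|$ in the incoherent basis. The fidelity is $F(\rho,\sigma)=\operatorname{Tr}\sqrt{\sqrt\sigma\rho\sqrt\sigma}$. $S(\rho)=-\operatorname{Tr}\rho\log_2\rho$ is the von Neumann entropy. An incoherent operation $\Lambda$ from $\mathcal H$ to $\mathcal H'$ is a completely positive trace-preserving map admitting a Kraus decomposition $\Lambda(X)=\sum_n K_nXK_n^\dagger$ such that, for every $n$ and every incoherent state $\delta$ on $\mathcal H$, $K_n\delta K_n^\dagger$ is diagonal in the incoherent basis of $\mathcal H'$. $|\Phi_M\rangle=\frac1{\sqrt M}\sum_{i=1}^M|i\rangle$ is the maximally coherent state on an $M$-dimensional space with incoherent basis $\{|i\rangle\}_{i=1}^M$. For a finite pure state ensemble $\mathfrak E=\{p_i,\psi_i\}_i$ ($p_i>0$, $\sum_ip_i=1$) and $0\le\epsilon<1$, $$C_c(\mathfrak E,\epsilon)=\max_{M\in\mathbb N}\Big\{\log_2M:\ \max_{\{\Lambda_i\}_i}F^2\Big(\sum_ip_i\Lambda_i(\psi_i),\Phi_M\Big)\ge1-\epsilon\Big\},$$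 with each $\Lambda_i$ ranging over incoherent operations with output in the $M$-dimensional space. The one-shot coherence of assistance is $C_a(\rho,\epsilon)=\max_{\mathfrak E}C_c(\mathfrak E,\epsilon)$, the maximum being over all pure state ensembles $\mathfrak E=\{p_i,\psi_i\}_i$ with $\sum_ip_i\psi_i=\rho$, and its asymptotic limit is $$C_a^\infty(\rho)=\lim_{\epsilon\to0}\lim_{n\to\infty}\frac1nC_a(\rho^{\otimes n},\epsilon).$$ The coherence of assistance and its regularization are $$D_a(\rho)=\max_{\{p_i,\psi_i\}_i:\ \sum_ip_i\psi_i=\rho}\ \sum_ip_iS(\Delta(\psi_i)),\qquad D_a^\infty(\rho)=\lim_{n\to\infty}\frac1nD_a(\rho^{\otimes n}).$$ *)

(* Defs.v *)
From mathcomp Require Import all_boot all_order all_algebra.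
From mathcomp Require Import all_classical all_reals all_analysis.
From mathcomp Require Import complex mxtens.

Set Implicit Arguments.
Unset Strict Implicit.
Unset Printing Implicit Defensive.

Import Order.TTheory GRing.Theory Num.Theory.
Import numFieldNormedType.Exports.

Local Open Scope classical_set_scope.
Local Open Scope ring_scope.
Local Open Scope complex_scope.

(* The Hilbert space of dimension d is R[i]^d, with the canonical basis as its
   incoherent basis.  Kets are column vectors and operators are square
   matrices.  [tensmx] indexes the tensor product by [mxtens_index], so the
   canonical basis of R[i]^(d ^ n) is the product basis. *)

Definition adjmx (R : rcfType) (m n : nat) (A : 'M[R[i]]_(m, n)) :
  'M[R[i]]_(n, m) := map_mx Num.conj A^T.

Definition ketbra (R : rcfType) (d : nat) (psi : 'cV[R[i]]_d) : 'M[R[i]]_d :=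
  psi *m adjmx psi.

Definition unit_vector (R : rcfType) (d : nat) (psi : 'cV[R[i]]_d) : Prop :=
  adjmx psi *m psi = 1%:M.

Definition psdmx (R : rcfType) (d : nat) (A : 'M[R[i]]_d) : Prop :=
  A \is hermsymmx /\ forall v : 'cV[R[i]]_d, 0 <= (adjmx v *m A *m v) ord0 ord0.

Definition density (R : rcfType) (d : nat) (rho : 'M[R[i]]_d) : Prop :=
  psdmx rho /\ \tr rho = 1.

Definition incoherent_state (R : rcfType) (d : nat) (rho : 'M[R[i]]_d) : Prop :=
  density rho /\ is_diag_mx rho.

Definition dephase (R : rcfType) (d : nat) (X : 'M[R[i]]_d) : 'M[R[i]]_d :=
  \sum_i delta_mx i i *m X *m delta_mx i i.

(* Functional calculus for Hermitian A, whose eigenvalues are real; the result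
   does not depend on the chosen diagonalization. *)
Definition mxfun (R : rcfType) (f : R -> R) (d : nat) (A : 'M[R[i]]_d) :
  'M[R[i]]_d :=
  invmx (spectralmx A)
    *m diag_mx (map_mx (fun z => (f (complex.Re z))%:C) (spectral_diag A))
    *m spectralmx A.

Definition sqrtmx (R : rcfType) (d : nat) (A : 'M[R[i]]_d) : 'M[R[i]]_d :=
  mxfun (@Num.sqrt R) A.

Definition fidelity (R : rcfType) (d : nat) (rho sigma : 'M[R[i]]_d) : R :=
  complex.Re (\tr (sqrtmx (sqrtmx sigma *m rho *m sqrtmx sigma))).

(* [ln x = 0] for [x <= 0], which gives the usual convention 0 log 0 = 0 in the
   entropy. *)
Definition log2 (R : realType) (x : R) : R := ln x / ln 2.

Definition entropy (R : realType) (d : nat) (rho : 'M[R[i]]_d) : R :=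
  - complex.Re (\tr (rho *m mxfun (@log2 R) rho)).

(* The map id_k (x) Lambda, applied blockwise. *)
Definition ampliation (R : rcfType) (m n k : nat)
    (Lambda : 'M[R[i]]_m -> 'M[R[i]]_n) (X : 'M[R[i]]_(k * m)) :
    'M[R[i]]_(k * n) :=
  \sum_(a < k) \sum_(b < k)
    tensmx (delta_mx a b : 'M[R[i]]_k)
      (Lambda (\matrix_(i < m, j < m)
                 X (mxtens_index (a, i)) (mxtens_index (b, j)))).

Definition completely_positive (R : rcfType) (m n : nat)
    (Lambda : 'M[R[i]]_m -> 'M[R[i]]_n) : Prop :=
  linear Lambda /\
  forall (k : nat) (X : 'M[R[i]]_(k * m)), psdmx X -> psdmx (ampliation Lambda X).

Definition trace_preserving (R : rcfType) (m n : nat)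
    (Lambda : 'M[R[i]]_m -> 'M[R[i]]_n) : Prop :=
  forall X, \tr (Lambda X) = \tr X.

Definition incoherent_operation (R : rcfType) (m n : nat)
    (Lambda : 'M[R[i]]_m -> 'M[R[i]]_n) : Prop :=
  [/\ completely_positive Lambda,
      trace_preserving Lambda
    & exists (r : nat) (K : 'I_r -> 'M[R[i]]_(n, m)),
        (forall X, Lambda X = \sum_l K l *m X *m adjmx (K l)) /\
        (forall (l : 'I_r) (delta : 'M[R[i]]_m), incoherent_state delta ->
           is_diag_mx (K l *m delta *m adjmx (K l)))].

Definition max_coherent (R : rcfType) (M : nat) : 'cV[R[i]]_M :=
  const_mx ((Num.sqrt M%:R)^-1)%:C.

Record ensemble (R : realType) (d : nat) := Ensemble {
  ens_size : nat;
  ens_prob : 'I_ens_size -> R;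
  ens_ket : 'I_ens_size -> 'cV[R[i]]_d;
  ens_prob_gt0 : forall i, 0 < ens_prob i;
  ens_prob_sum : \sum_i ens_prob i = 1;
  ens_ket_unit : forall i, unit_vector (ens_ket i)
}.

Arguments ens_prob {R d} E i : rename.
Arguments ens_ket {R d} E i : rename.

Definition ens_density (R : realType) (d : nat) (E : ensemble R d) :
  'M[R[i]]_d := \sum_i (ens_prob E i)%:C *: ketbra (ens_ket E i).

(* [sup] renders the maxima below.  For a state rho, 0 <= eps < 1 and M > 0,
   the sets are nonempty and bounded, and the maxima are attained. *)

Definition distill_fidelity2 (R : realType) (d : nat) (E : ensemble R d)
    (M : nat) : R :=
  sup [set x | exists Lambda : 'I_(ens_size E) -> 'M[R[i]]_d -> 'M[R[i]]_M,
         (forall i, incoherent_operation (Lambda i)) /\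
         x = fidelity
               (\sum_i (ens_prob E i)%:C *: Lambda i (ketbra (ens_ket E i)))
               (ketbra (max_coherent R M)) ^+ 2].

Definition C_c (R : realType) (d : nat) (E : ensemble R d) (eps : R) : R :=
  sup [set x | exists M : nat,
         [/\ (0 < M)%N, 1 - eps <= distill_fidelity2 E M & x = log2 M%:R]].

Definition C_a (R : realType) (d : nat) (rho : 'M[R[i]]_d) (eps : R) : R :=
  sup [set C_c E eps | E in [set E : ensemble R d | ens_density E = rho]].

Definition D_a (R : realType) (d : nat) (rho : 'M[R[i]]_d) : R :=
  sup [set \sum_i ens_prob E i * entropy (dephase (ketbra (ens_ket E i)))
        | E in [set E : ensemble R d | ens_density E = rho]].

Definition C_a_rate (R : realType) (d : nat) (rho : 'M[R[i]]_d) (eps : R)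
    (n : nat) : R := n%:R^-1 * C_a (ntensmx rho n) eps.

Definition D_a_rate (R : realType) (d : nat) (rho : 'M[R[i]]_d) (n : nat) : R :=
  n%:R^-1 * D_a (ntensmx rho n).

Definition C_a_infty (R : realType) (d : nat) (rho : 'M[R[i]]_d) : R :=
  lim (limn (C_a_rate rho eps) @[eps --> 0^'+]).

Definition D_a_infty (R : realType) (d : nat) (rho : 'M[R[i]]_d) : R :=
  limn (D_a_rate rho).

(* Main.v *)
Require Import Defs.
From mathcomp Require Import all_boot all_order all_algebra.
From mathcomp Require Import all_classical all_reals all_analysis.
From mathcomp Require Import complex mxtens ring lra zify.

(* Let P be the diagonal of sigma = rho^(tensor n).  Both D_a(sigma) and
   C_a(sigma, eps), for every fixed eps in (0, 1), equal H(P) / ln 2 up to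
   O(sqrt n), and H(P) = n H(diag rho); so all the limits exist and are equal to
   the entropy of the dephased state.

   Upper bounds.  Concavity of the entropy gives D_a(sigma) <= H(P) / ln 2.
   For every set T of basis indices, an incoherent operation maps a unit vector
   psi to a state whose overlap with the maximally coherent state Phi_M is at
   most 2 (|T| / M + |psi|^2 (complement of T)); with T a typical set of P this
   bounds the achievable M, by Chebyshev's inequality for ln P.

   Lower bounds.  Write sigma = A A^*, with the columns of A orthogonal, and
   take the ensemble psi_e = A e for uniformly random sign vectors e.  Each
   Q_e(x) = |psi_e(x)|^2 has mean P(x) and second moment at most 3 P(x)^2.  By
   convexity the mean of H(Q_e) is at least H(P) - ln 3.  Moreover, measuring
   which block of M consecutive indices occurs, when the indices are sorted by
   decreasing |psi|, then relabelling inside the block and removing the phases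
   is an incoherent operation whose overlap with Phi_M is at least
   1 - Q_e(first block), and the second moments make Q_e(first block) small on
   average. *)

Set Implicit Arguments.
Unset Strict Implicit.
Unset Printing Implicit Defensive.

Import Order.TTheory GRing.Theory Num.Theory.
Import numFieldNormedType.Exports.
Local Open Scope ring_scope.

(** * Entropy of probability vectors *)

(** The convex function q ln q lies above its tangent at [c]. There is no tangent at 0, so there [q]
    must vanish too. *)
Lemma mul_ln_ge (R : realType) (q c : R) : 0 <= q -> 0 <= c ->
  (c = 0 -> q = 0) -> q * ln c + q - c <= q * ln q.
Proof.
move=> q0 c0 cq; have [->|qn0] := eqVneq q 0.
  by rewrite !mul0r add0r sub0r oppr_le0.
have qp : 0 < q by rewrite lt0r qn0.
have cp : 0 < c by rewrite lt0r c0 andbT; apply: contra_neq qn0.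
have := @le_ln1Dx R (c / q - 1).
rewrite addrCA subrr addr0 ln_div ?posrE // => /(_ _) h.
have {}h : ln c - ln q <= c / q - 1.
  by apply: h; rewrite ltrBDl addrN divr_gt0.
have := ler_wpM2l q0 h.
rewrite !mulrBr mulr1 mulrCA divff // mulr1; lra.
Qed.

(** This is ln(q/c) <= q/c - 1 multiplied by [q]. It bounds a mean of q ln q by first and second
    moments. *)
Lemma mul_ln_le (R : realType) (q c : R) : 0 <= q -> 0 < c ->
  q * ln q <= q * ln c + q ^+ 2 / c - q.
Proof.
move=> q0 c0; have [->|qn0] := eqVneq q 0.
  by rewrite !mul0r expr0n /= mul0r addr0 subrr.
have qp : 0 < q by rewrite lt0r qn0.
have := @le_ln1Dx R (q / c - 1).
rewrite addrCA subrr addr0 ln_div ?posrE // => /(_ _) h.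
have {}h : ln q - ln c <= q / c - 1.
  by apply: h; rewrite ltrBDl addrN divr_gt0.
have := ler_wpM2l q0 h.
rewrite !mulrBr mulr1 expr2 -mulrA; lra.
Qed.

Definition probvec (R : realType) (I : finType) (p : I -> R) : Prop :=
  (forall i, 0 <= p i) /\ \sum_i p i = 1.

Definition shannon (R : realType) (I : finType) (p : I -> R) : R :=
  - \sum_i p i * ln (p i).

(** The variance of ln p under a probability vector [p], the mean of ln p being [- shannon p]. *)
Definition varentropy (R : realType) (I : finType) (p : I -> R) : R :=
  \sum_i p i * (ln (p i) + shannon p) ^+ 2.

Lemma probvec_le1 (R : realType) (I : finType) (p : I -> R) i :
  probvec p -> p i <= 1.
Proof.
move=> [p0 p1]; rewrite -p1 (bigD1 i) //= lerDl; exact: sumr_ge0.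
Qed.

Lemma shannon_ge0 (R : realType) (I : finType) (p : I -> R) :
  probvec p -> 0 <= shannon p.
Proof.
move=> hp; rewrite /shannon -sumrN; apply: sumr_ge0 => i _.
rewrite oppr_ge0 mulr_ge0_le0 ?(proj1 hp) //.
exact/ln_le0/probvec_le1.
Qed.

Lemma varentropy_ge0 (R : realType) (I : finType) (p : I -> R) :
  probvec p -> 0 <= varentropy p.
Proof.
by move=> [p0 _]; apply: sumr_ge0 => i _; rewrite mulr_ge0 ?sqr_ge0.
Qed.

(** Chebyshev's inequality for ln p. Points with [p i = 0] carry no mass, so the deviation is
    assumed only where [p i] is positive. *)
Lemma varentropy_tail (R : realType) (I : finType) (p : I -> R) (A : pred I)
    (s : R) : probvec p -> 0 < s ->
  (forall i, A i -> 0 < p i -> s ^+ 2 <= (ln (p i) + shannon p) ^+ 2) ->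
  \sum_(i | A i) p i <= varentropy p / s ^+ 2.
Proof.
move=> hp s0 hA; have [p0 _] := hp; rewrite ler_pdivlMr ?exprn_gt0 //.
rewrite /varentropy [leRHS](bigID A) /= -[leLHS]addr0.
apply: lerD; last first.
  by apply: sumr_ge0 => i _; rewrite mulr_ge0 ?sqr_ge0.
rewrite mulr_suml; apply: ler_sum => i Ai.
have [->|pn0] := eqVneq (p i) 0; first by rewrite !mul0r.
by rewrite ler_wpM2l // hA // lt0r pn0 p0.
Qed.

Lemma card_gt_mass (R : realType) (I : finType) (p : I -> R) (A : pred I)
    (c : R) : probvec p -> 0 < c -> (forall i, A i -> c <= p i) ->
  #|A|%:R <= c^-1.
Proof.
move=> hp c0 hA; rewrite -[leRHS]mul1r ler_pdivlMr //.
rewrite -[leRHS](proj2 hp).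
rewrite mulr_natl -sumr_const [leRHS](bigID A) /= -[leLHS]addr0.
apply: lerD; first by apply: ler_sum => i; apply: hA.
by apply: sumr_ge0 => i _; apply: (proj1 hp).
Qed.

Lemma shannon_lower_tail (R : realType) (I : finType) (p : I -> R) (s : R) :
  probvec p -> 0 < s ->
  \sum_(i | p i < expR (- (shannon p + s))) p i <= varentropy p / s ^+ 2.
Proof.
move=> hp s0; apply: varentropy_tail => // i /= pi p0.
have : ln (p i) <= - (shannon p + s).
  by rewrite -[leRHS]expRK ler_ln ?posrE ?expR_gt0 // ltW.
nra.
Qed.

Lemma shannon_upper_tail (R : realType) (I : finType) (p : I -> R) (s : R) :
  probvec p -> 0 < s ->
  \sum_(i | expR (s - shannon p) < p i) p i <= varentropy p / s ^+ 2.
Proof.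
move=> hp s0; apply: varentropy_tail => // i /= pi p0.
have : s - shannon p <= ln (p i).
  by rewrite -[leLHS]expRK ler_ln ?posrE ?expR_gt0 // ltW.
nra.
Qed.

Lemma sum_mxtens (V : nmodType) (m n : nat) (F : 'I_m -> 'I_n -> V) :
  \sum_(k < m * n) F (mxtens_unindex k).1 (mxtens_unindex k).2 =
  \sum_i \sum_j F i j.
Proof.
rewrite pair_big /=; symmetry.
rewrite (reindex (@mxtens_unindex m n)) //=.
by exists (@mxtens_index m n) => i _; rewrite (mxtens_indexK, mxtens_unindexK).
Qed.

Definition tensp (R : realType) (m n : nat) (p : 'I_m -> R) (q : 'I_n -> R)
    (k : 'I_(m * n)) : R := p (mxtens_unindex k).1 * q (mxtens_unindex k).2.

(** The prefactor [a * b] makes the logarithm law hold also when a factor vanishes. *)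
Lemma mul_lnM (R : realType) (a b c : R) : 0 <= a -> 0 <= b ->
  a * b * (ln (a * b) + c) = a * b * (ln a + ln b + c).
Proof.
move=> a0 b0; have [->|an0] := eqVneq a 0; first by rewrite !mul0r.
have [->|bn0] := eqVneq b 0; first by rewrite mulr0 !mul0r.
by rewrite lnM // posrE lt0r ?an0 ?bn0.
Qed.

Lemma shannon_tens (R : realType) (m n : nat) (p : 'I_m -> R) (q : 'I_n -> R) :
  probvec p -> probvec q -> shannon (tensp p q) = shannon p + shannon q.
Proof.
move=> [p0 p1] [q0 q1]; rewrite /shannon.
rewrite (sum_mxtens (fun i j => p i * q j * ln (p i * q j))).
rewrite -opprD; congr (- _).
transitivity (\sum_i (p i * ln (p i) * (\sum_j q j)
    + p i * \sum_j q j * ln (q j))).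
  apply: eq_bigr => i _; rewrite !mulr_sumr -big_split /=.
  apply: eq_bigr => j _; have := mul_lnM 0 (p0 i) (q0 j).
  by rewrite !addr0 => ->; ring.
by rewrite big_split /= -!mulr_suml p1 q1 mulr1 mul1r.
Qed.

(** Variances of independent variables add: the cross term contains the mean of a centred logarithm,
    which is 0. *)
Lemma varentropy_tens (R : realType) (m n : nat) (p : 'I_m -> R)
    (q : 'I_n -> R) : probvec p -> probvec q ->
  varentropy (tensp p q) = varentropy p + varentropy q.
Proof.
move=> hp hq; rewrite /varentropy shannon_tens //.
have [[p0 p1] [q0 q1]] := (hp, hq).
set h := shannon p; set k := shannon q.
have hE : \sum_i p i * (ln (p i) + h) = 0.
  under eq_bigr do rewrite mulrDr.
  by rewrite big_split /= -mulr_suml p1 mul1r addrN.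
have kE : \sum_i q i * (ln (q i) + k) = 0.
  under eq_bigr do rewrite mulrDr.
  by rewrite big_split /= -mulr_suml q1 mul1r addrN.
rewrite (sum_mxtens (fun i j => p i * q j * (ln (p i * q j) + (h + k)) ^+ 2)).
transitivity (\sum_i (p i * (ln (p i) + h) ^+ 2 * (\sum_j q j)
    + p i * (\sum_j q j * (ln (q j) + k) ^+ 2)
    + 2 * (p i * (ln (p i) + h)) * \sum_j q j * (ln (q j) + k))).
  apply: eq_bigr => i _; rewrite !mulr_sumr -!big_split /=.
  apply: eq_bigr => j _; rewrite expr2 mulrA mul_lnM // mulrAC mul_lnM //.
  by ring.
rewrite q1 kE !big_split /= -mulr_suml -!mulr_suml p1 mulr1 mul1r mulr0 addr0.
by [].
Qed.

(** * Random signs *)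

Section Signs.
Variables (R : realFieldType) (N : nat).
Implicit Types (e : {ffun 'I_N -> bool}) (k l : 'I_N).

Definition flip k e : {ffun 'I_N -> bool} := [ffun l => (l == k) (+) e l].

Lemma flipK k : involutive (flip k).
Proof. by move=> e; apply/ffunP => l; rewrite !ffunE addbA addbb. Qed.

Definition sg (S : pzRingType) e k : S := (-1) ^+ e k.

Lemma sg_flip (S : pzRingType) k e : sg S (flip k e) k = - sg S e k.
Proof. by rewrite /sg ffunE eqxx addTb signrN. Qed.

Lemma sg_flip_neq (S : pzRingType) k l e : l != k ->
  sg S (flip k e) l = sg S e l.
Proof. by move=> /negbTE lk; rewrite /sg ffunE lk addFb. Qed.

(** Pairing each sign vector with its flip at [k] cancels every term that is odd in the sign of
    [k]. *)
Lemma sum_flip (V : nmodType) k (F : {ffun 'I_N -> bool} -> V) :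
  (\sum_e F e) *+ 2 = \sum_e (F e + F (flip k e)).
Proof.
rewrite big_split /= mulr2n; congr (_ + _).
exact: reindex_inj (inv_inj (flipK k)).
Qed.

Lemma sum_sg_sg (S : numDomainType) k l :
  \sum_e sg S e k * sg S e l = (2 ^ N)%:R * (k == l)%:R.
Proof.
have [->|kl] := eqVneq k l.
  under eq_bigr do rewrite /sg -expr2 sqrr_sign.
  by rewrite sumr_const card_ffun card_bool card_ord mulr1.
rewrite mulr0; apply/eqP; suff: (\sum_e sg S e k * sg S e l) *+ 2 == 0.
  by rewrite mulrn_eq0.
rewrite (sum_flip k) big1 // => e _.
by rewrite sg_flip sg_flip_neq 1?eq_sym // mulNr addrN.
Qed.

Variables x y : 'I_N -> R.

Let S (r : seq 'I_N) (z : 'I_N -> R) e : R := \sum_(k <- r) sg R e k * z k.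

Let S_cons k r z e : S (k :: r) z e = sg R e k * z k + S r z e.
Proof. by rewrite /S big_cons. Qed.

Let S_flip k r z e : k \notin r -> S r z (flip k e) = S r z e.
Proof.
move=> kr; apply: eq_big_seq => l lr; rewrite sg_flip_neq //.
by apply: contraNneq kr => <-.
Qed.

Let sg2 e k : sg R e k ^+ 2 = 1. Proof. exact: sqrr_sign. Qed.

(** With z_k = x_k + i y_k, these are the second and fourth absolute moments of the randomly signed
    sum S of the z_k. By induction on [r], averaging over the sign of a new term with |z_k|^2 = a
    gives |S|^2 + a, and at most |S|^4 + 6 a |S|^2 + a^2. Summing the latter uses the second moment
    for [r], so both are proved together. *)
Lemma sum_sg_moments (r : seq 'I_N) : uniq r ->
  let s := \sum_(k <- r) (x k ^+ 2 + y k ^+ 2) in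
  \sum_e (S r x e ^+ 2 + S r y e ^+ 2) = (2 ^ N)%:R * s /\
  \sum_e (S r x e ^+ 2 + S r y e ^+ 2) ^+ 2 <= (2 ^ N)%:R * (3 * s ^+ 2).
Proof.
elim: r => [|k r IH] /=.
  move=> _; rewrite big_nil expr0n /= !mulr0; split.
    by rewrite big1 // => e _; rewrite /S !big_nil expr0n /= addr0.
  by rewrite big1 // => e _; rewrite /S !big_nil expr0n /= addr0 expr0n.
case/andP => kr /IH []; rewrite big_cons.
set s := \sum_(l <- r) _; set n := (2 ^ N)%:R => E1 E2.
set a := x k ^+ 2 + y k ^+ 2.
have n1 : \sum_(e : {ffun 'I_N -> bool}) 1 = n :> R.
  by rewrite sumr_const card_ffun card_bool card_ord.
have n0 : 0 <= n by rewrite ler0n.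
have a0 : 0 <= a by rewrite addr_ge0 ?sqr_ge0.
split.
  apply: (@mulIf R 2); first by rewrite pnatr_eq0.
  rewrite mulr_natr (sum_flip k).
  transitivity (\sum_e (2 * (S r x e ^+ 2 + S r y e ^+ 2) + 2 * a * 1)).
    apply: eq_bigr => e _; rewrite !S_cons !sg_flip !S_flip //.
    have := sg2 e k; rewrite /a; move: (sg R e k) => c c2.
    transitivity (2 * (S r x e ^+ 2 + S r y e ^+ 2)
      + 2 * (x k ^+ 2 + y k ^+ 2) * c ^+ 2); first by ring.
    by rewrite c2.
  by rewrite big_split /= -!mulr_sumr E1 n1; ring.
rewrite -(ler_pM2r (ltr0n R 2)) mulr_natr (sum_flip k).
have le : \sum_e (2 * (S r x e ^+ 2 + S r y e ^+ 2) ^+ 2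
   + 12 * a * (S r x e ^+ 2 + S r y e ^+ 2) + 2 * a ^+ 2 * 1)
   <= n * (3 * (a + s) ^+ 2) * 2.
  rewrite !big_split /= -!mulr_sumr E1 n1.
  have : 0 <= n * a ^+ 2 by rewrite mulr_ge0 ?sqr_ge0.
  nra.
apply: le_trans le; apply: ler_sum => e _.
rewrite !S_cons !sg_flip !S_flip //.
have := sg2 e k; rewrite /a; move: (sg R e k) => c c2.
set X := S r x e; set Y := S r y e.
rewrite [leLHS](_ : _ = 2 * (X ^+ 2 + Y ^+ 2
    + (x k ^+ 2 + y k ^+ 2) * c ^+ 2) ^+ 2
    + 8 * c ^+ 2 * (x k * X + y k * Y) ^+ 2); last by ring.
rewrite c2 !mulr1.
(* By Lagrange's identity this square is the defect in the Cauchy-Schwarz bound for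
   [x k * X + y k * Y]. *)
have : 0 <= (x k * Y - y k * X) ^+ 2 by apply: sqr_ge0.
nra.
Qed.

Lemma sum_sg_fourth_moment :
  \sum_e ((\sum_k sg R e k * x k) ^+ 2 + (\sum_k sg R e k * y k) ^+ 2) ^+ 2
  <= (2 ^ N)%:R * (3 * (\sum_k (x k ^+ 2 + y k ^+ 2)) ^+ 2).
Proof. by have [] := sum_sg_moments (index_enum_uniq 'I_N). Qed.

End Signs.

(** * Blocks of consecutive ranks *)

Section Blocks.
Variables (R : realFieldType) (N M : nat) (b : 'I_N -> R).
Hypothesis M0 : (0 < M)%N.

Lemma sorting_rank : exists2 rk : 'I_N -> 'I_N, injective rk &
  forall i j, (rk j <= rk i)%N -> b i <= b j.
Proof.
pose le := relpre b (>=%R : rel R).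
have le_tot : total le by move=> i j; apply: le_total.
have le_tr : transitive le by move=> j i k /= ij jk; apply: le_trans jk ij.
pose s := sort le (enum 'I_N).
have us : uniq s by rewrite sort_uniq enum_uniq.
have ms i : i \in s by rewrite mem_sort mem_enum.
have ss : size s = N by rewrite size_sort size_enum_ord.
have si i : (index i s < N)%N by rewrite -[ltnRHS]ss index_mem.
exists (fun i => Ordinal (si i)).
  by move=> i j [] /(congr1 (nth i s)); rewrite !nth_index.
move=> i j /= ij.
have := sorted_leq_index le_tr (fun i => lexx (b i)) (sort_sorted le_tot _).
by move=> /(_ (enum 'I_N) _ _ (ms j) (ms i) ij).
Qed.

(** Inside a block, the remainder of the rank modulo [M] determines the index. *)
Lemma card_block (rk : 'I_N -> 'I_N) r : injective rk ->
  (#|[set i | rk i %/ M == r]| <= M)%N.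
Proof.
move=> rkI; rewrite -[leqRHS]card_ord.
pose f i := Ordinal (ltn_pmod (rk i) M0).
rewrite -(@card_in_imset _ _ f) ?max_card // => i j.
rewrite !inE => /eqP ri /eqP rj [] fij; apply/rkI/val_inj => /=.
by rewrite (divn_eq (rk i) M) (divn_eq (rk j) M) ri rj fij.
Qed.

Lemma card_full_block (rk : 'I_N -> 'I_N) (r : nat) : injective rk ->
  (r * M + M <= N)%N -> (M <= #|[set i | rk i %/ M == r]|)%N.
Proof.
move=> rkI rN; rewrite -[leqLHS]card_ord.
have lt (k : 'I_M) : (r * M + k < N)%N.
  by apply: leq_trans rN; rewrite ltn_add2l.
pose f k := invF rkI (Ordinal (lt k)).
have fI : injective f.
  by move=> k l /(congr1 rk); rewrite !f_invF => -[] /addnI /val_inj.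
rewrite -(card_imset _ fI); apply: subset_leq_card.
apply/fintype.subsetP => i /imsetP[k _ ->]; rewrite inE f_invF /=.
by rewrite divnMDl // divn_small // addn0.
Qed.

End Blocks.

(** Every entry of block r + 1 is at most s / M, with s the sum over block r, so the squares over
    block r + 1 add up to at most M (s / M)^2 = s^2 / M. Summing over r covers everything outside
    block 0. *)
Lemma block_sum (R : realFieldType) (N M : nat) (b : 'I_N -> R) :
  (0 < M)%N -> (forall i, 0 <= b i) -> exists2 rk : 'I_N -> 'I_N, injective rk &
  \sum_i b i ^+ 2 - \sum_(i | (rk i < M)%N) b i ^+ 2 <=
  \sum_(r < N) (\sum_(i | (rk i %/ M)%N == r) b i) ^+ 2 / M%:R.
Proof.
move=> M0 b0; have [rk rkI rkb] := sorting_rank b; exists rk => //.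
rewrite [X in X - _](bigID (fun i => (rk i < M)%N)) /= addrAC subrr add0r.
case: N b b0 rk rkI rkb => [|n] c c0 rk rkI rkb.
  by rewrite big_ord0 big1 // => -[].
(* Each index outside block 0 is charged to the preceding block. [inord] needs a nonempty ordinal
   type, hence the case split on [N]. *)
rewrite (partition_big (fun i => inord (rk i %/ M)%N.-1 : 'I_n.+1) predT) //=.
apply: ler_sum => r _; set s := \sum_(i | _) c i.
have Mr : 0 < M%:R :> R by rewrite ltr0n.
have s0 : 0 <= s by apply: sumr_ge0.
have sub i : ~~ (rk i < M)%N && (inord (rk i %/ M)%N.-1 == r :> 'I_n.+1) ->
    (rk i %/ M)%N = r.+1.
  case/andP; rewrite -leqNgt => Mi /eqP <-; rewrite inordK.
    by rewrite prednK // divn_gt0.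
  by apply: leq_ltn_trans (leq_pred _) _; apply: leq_ltn_trans (leq_div _ _) _.
have le i : (rk i %/ M)%N = r.+1 -> c i <= s / M%:R.
  move=> ri; rewrite ler_pdivlMr // mulr_natr.
  (* An index in block r + 1 shows that block r is full, so [s] has at least [M] terms. *)
  have full : (r * M + M <= n.+1)%N.
    rewrite -mulSnr -ri; apply: leq_trans (leq_trunc_div _ _) _.
    exact: ltnW.
  apply: le_trans (_ : c i *+ #|[set j | (rk j %/ M)%N == r]| <= _).
    by apply: ler_wpMn2l => //; apply: card_full_block.
  rewrite -sumr_const big_mkcond [s]big_mkcond /=; apply: ler_sum => j _.
  rewrite inE; case: eqP => // rj; apply: rkb.
  rewrite (divn_eq (rk j) M) rj (divn_eq (rk i) M) ri mulSn.
  by have := ltn_pmod (rk j) M0; lia.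
rewrite (_ : s ^+ 2 / M%:R = (s / M%:R) ^+ 2 *+ M); last first.
  by rewrite -mulr_natr; field; rewrite gt_eqF.
apply: le_trans
  (_ : (s / M%:R) ^+ 2 *+ #|[set i | (rk i %/ M)%N == r.+1]| <= _).
  rewrite -sumr_const big_mkcond [leRHS]big_mkcond /=; apply: ler_sum => i _.
  rewrite inE; case: ifP => [/sub ri|_]; last by case: ifP; rewrite ?sqr_ge0.
  rewrite ri eqxx ler_sqr ?nnegrE ?le ?divr_ge0 //; exact: ltW.
by apply: ler_wpMn2l; rewrite ?sqr_ge0 ?card_block.
Qed.

Local Open Scope complex_scope.

(** * Matrices and incoherent operations *)

Definition nsq (R : rcfType) (z : R[i]) : R :=
  complex.Re z ^+ 2 + complex.Im z ^+ 2.

Section Nsq.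
Variable R : rcfType.
Implicit Types z w : R[i].

Lemma mulcJ z : z * Num.conj z = (nsq z)%:C.
Proof. by rewrite -normCK -add_Re2_Im2. Qed.

Lemma nsq_ge0 z : 0 <= nsq z.
Proof. by rewrite addr_ge0 ?sqr_ge0. Qed.

Lemma nsqM z w : nsq (z * w) = nsq z * nsq w.
Proof. by case: z w => [a b] [c d]; rewrite /nsq /=; ring. Qed.

Lemma nsqC (a : R) : nsq a%:C = a ^+ 2.
Proof. by rewrite /nsq /= expr0n addr0. Qed.

Lemma nsqJ z : nsq (Num.conj z) = nsq z.
Proof. by apply: complexI; rewrite -!mulcJ conjCK mulrC. Qed.

Lemma nsqD_le z w : nsq (z + w) <= 2 * (nsq z + nsq w).
Proof.
case: z w => [a b] [c d]; rewrite /nsq /=.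
have := sqr_ge0 (a - c); have := sqr_ge0 (b - d); nra.
Qed.

Lemma nsq_eq0 z : (nsq z == 0) = (z == 0).
Proof.
by rewrite paddr_eq0 ?sqr_ge0 // !sqrf_eq0 eq_complex.
Qed.

Lemma conjcE z : Num.conj z = conjc z.
Proof. by []. Qed.

Lemma Re_sum (I : Type) (r : seq I) (P : pred I) (F : I -> R[i]) :
  complex.Re (\sum_(i <- r | P i) F i) = \sum_(i <- r | P i) complex.Re (F i).
Proof. exact: (raddf_sum (@complex.Re R : Rcomplex R -> R)). Qed.

Lemma Re_scale (a : R) z : complex.Re (a%:C * z) = a * complex.Re z.
Proof. by case: z => x y /=; rewrite mul0r subr0. Qed.

(** Cauchy-Schwarz: expanding the sum of |U conj(v_i) - conj(S) u_i|^2 gives U (U V - |S|^2) >= 0.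
    If U = 0, all [u i] with [i] in [T] vanish. *)
Lemma nsq_sum_mul_le (I : finType) (T : pred I) (u v : I -> R[i]) :
  nsq (\sum_(i | T i) u i * v i) <=
  (\sum_(i | T i) nsq (u i)) * (\sum_(i | T i) nsq (v i)).
Proof.
set U := \sum_(i | T i) nsq (u i); set V := \sum_(i | T i) nsq (v i).
set S := \sum_(i | T i) _.
have U0 : 0 <= U by apply: sumr_ge0 => i _; apply: nsq_ge0.
have V0 : 0 <= V by apply: sumr_ge0 => i _; apply: nsq_ge0.
have key : 0 <= U * (U * V - nsq S).
  have : 0 <= \sum_(i | T i)
     nsq (U%:C * Num.conj (v i) - Num.conj S * u i).
    by apply: sumr_ge0 => i _; apply: nsq_ge0.
  rewrite [X in _ <= X -> _](_ : _ = U * (U * V - nsq S)) //.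
  transitivity (\sum_(i | T i) (U ^+ 2 * nsq (v i) + nsq S * nsq (u i)
      - 2 * U * complex.Re (Num.conj S * (u i * v i)))).
    apply: eq_bigr => i _; rewrite !conjcE.
    move: (u i) (v i) S => [a b] [c d] [e f]; rewrite /nsq /=; ring.
  rewrite !big_split /= sumrN -!mulr_sumr -Re_sum -mulr_sumr -/S -/U -/V.
  rewrite [Num.conj S * _]mulrC mulcJ /=; ring.
have [U00|Un0] := eqVneq U 0; last first.
  by move: key; rewrite pmulr_rge0 ?subr_ge0 // lt0r Un0.
rewrite U00 mul0r /S big1 ?nsqC ?expr0n // => i Ti.
have /eqP : nsq (u i) = 0.
  apply/eqP; move/eqP: U00; rewrite psumr_eq0; last first.
    by move=> j _; apply: nsq_ge0.
  by move=> /allP /(_ i (mem_index_enum i)); rewrite Ti.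
by rewrite nsq_eq0 => /eqP ->; rewrite mul0r.
Qed.

End Nsq.

(** * Adjoints and functional calculus *)

Section Adjoint.
Variable R : rcfType.

Lemma adjmxE m n (A : 'M[R[i]]_(m, n)) i j :
  adjmx A i j = Num.conj (A j i).
Proof. by rewrite !mxE. Qed.

Lemma adjmxM m n p (A : 'M[R[i]]_(m, n)) (B : 'M[R[i]]_(n, p)) :
  adjmx (A *m B) = adjmx B *m adjmx A.
Proof. by rewrite /adjmx trmx_mul map_mxM. Qed.

Lemma adjmxK m n (A : 'M[R[i]]_(m, n)) : adjmx (adjmx A) = A.
Proof. by apply/matrixP => i j; rewrite !mxE conjCK. Qed.

Lemma hermP d (A : 'M[R[i]]_d) : reflect (adjmx A = A) (A \is hermsymmx).
Proof.
apply: (iffP (is_hermitianmxP _ _ _)); rewrite expr0 scale1r => h.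
  by rewrite {2}h.
by rewrite -[LHS]h.
Qed.

Lemma trace_ketbra d (v : 'cV[R[i]]_d) :
  \tr (ketbra v) = (\sum_x nsq (v x ord0))%:C.
Proof.
rewrite rmorph_sum; apply: eq_bigr => x _.
by rewrite !mxE big_ord1 !mxE mulcJ.
Qed.

Lemma unit_vectorP d (v : 'cV[R[i]]_d) :
  unit_vector v <-> \sum_x nsq (v x ord0) = 1.
Proof.
have E : adjmx v *m v = ((\sum_x nsq (v x ord0))%:C)%:M.
  rewrite [LHS]mx11_scalar; congr (_%:M); rewrite !mxE rmorph_sum.
  by apply: eq_bigr => x _; rewrite !mxE mulrC mulcJ.
rewrite /unit_vector E; split=> [|-> //].
by move=> /matrixP /(_ ord0 ord0); rewrite !mxE /= => -[].
Qed.

Lemma spectral_mul d (A : 'M[R[i]]_d) : A \is hermsymmx ->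
  spectralmx A *m A = diag_mx (spectral_diag A) *m spectralmx A.
Proof.
move=> /hermitian_normalmx /orthomx_spectralP hA.
by rewrite {2}hA !mulmxA mulmxV ?spectral_unit // mul1mx.
Qed.

Lemma mxfun_eq d (f : R -> R) (A B : 'M[R[i]]_d) :
  diag_mx (map_mx (fun z => (f (complex.Re z))%:C) (spectral_diag A))
    *m spectralmx A = spectralmx A *m B -> mxfun f A = B.
Proof.
by move=> h; rewrite /mxfun -mulmxA h mulKmx // spectral_unit.
Qed.

(** A nonzero entry (i, j) of [spectralmx A] forces the i-th eigenvalue to be [a j], so [f] of the
    one is [f] of the other. *)
Lemma mxfun_diag d (f : R -> R) (a : 'I_d -> R) :
  mxfun f (diag_mx (\row_j (a j)%:C)) = diag_mx (\row_j (f (a j))%:C).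
Proof.
set A := diag_mx _; have hA : A \is hermsymmx.
  apply/hermP/matrixP => i j; rewrite adjmxE !mxE.
  have [->|ij] := eqVneq i j; first by rewrite !mulr1n conjcE conjc_real.
  by rewrite !mulr0n rmorph0.
apply: mxfun_eq; apply/matrixP => i j.
have /matrixP/(_ i j) := spectral_mul hA.
rewrite !mul_diag_mx !mul_mx_diag !mxE.
have [->|S0] := eqVneq (spectralmx A i j) 0; first by rewrite !mulr0 !mul0r.
move=> h; have -> : spectral_diag A ord0 i = (a j)%:C.
  by apply: (mulIf S0); rewrite -h mulrC.
by rewrite mulrC.
Qed.

(** Since A^2 = c A passes to the diagonal form, all eigenvalues are 0 or [c]. As [f 0 = 0],
    applying [f] to them is multiplication by f(c) / c when [c] is nonzero. *)
Lemma mxfun_scale_proj d (f : R -> R) (c : R) (P : 'M[R[i]]_d) :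
  f 0 = 0 -> adjmx P = P -> P *m P = P ->
  mxfun f (c%:C *: P) = (f c)%:C *: P.
Proof.
move=> f0 hP PP; set A := _ *: P.
have hA : A \is hermsymmx.
  apply/hermP; rewrite /A -[in RHS]hP; apply/matrixP => i j.
  by rewrite !mxE rmorphM /= conjcE conjc_real.
apply: mxfun_eq; have := spectral_mul hA.
set S := spectralmx A; set D := spectral_diag A => h.
have US : S \in unitmx by apply: spectral_unit.
have [c0|cn0] := eqVneq c 0.
  have D0 : diag_mx D = 0.
    apply: (can_inj (mulmxK US)); rewrite -h /A c0 raddf0.
    by rewrite scale0r mulmx0 mul0mx.
  rewrite c0 f0 scale0r mulmx0 [X in X *m _](_ : _ = 0) ?mul0mx //.
  apply/matrixP => i j; have /matrixP/(_ i j) := D0; rewrite !mxE.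
  have [->|_] := eqVneq i j; last by rewrite !mulr0n.
  by rewrite !mulr1n => ->; rewrite f0.
have cC : (c%:C : R[i]) != 0 by rewrite (fmorph_eq0 (real_complex R)).
have DD : diag_mx D *m diag_mx D = c%:C *: diag_mx D.
  have AA : A *m A = c%:C *: A by rewrite /A -scalemxAl -scalemxAr PP.
  apply: (can_inj (mulmxK US)) => /=.
  by rewrite -mulmxA -h mulmxA -h -mulmxA AA -scalemxAl -h -scalemxAr.
have fD : diag_mx (map_mx (fun z => (f (complex.Re z))%:C) D)
    = (f c / c)%:C *: diag_mx D.
  apply/matrixP => i j; have /matrixP/(_ i i) := DD.
  rewrite mul_diag_mx !mxE eqxx !mulr1n.
  have [->|_] := eqVneq i j => dd; last by rewrite !mulr0n mulr0.
  rewrite !mulr1n; have [->|] := eqVneq (D ord0 j) 0.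
    by rewrite f0 mulr0.
  move=> Dn0; have -> : D ord0 j = c%:C by apply: (mulIf Dn0).
  by rewrite /= -rmorphM /= divfK.
rewrite fD -scalemxAl -h /A -!scalemxAr scalerA -rmorphM /= divfK //.
Qed.

End Adjoint.

(** * Pure states, Kraus maps and fidelity with a pure state *)

Section States.
Variable R : rcfType.

Lemma ketbra_herm d (v : 'cV[R[i]]_d) : adjmx (ketbra v) = ketbra v.
Proof. by rewrite /ketbra adjmxM adjmxK. Qed.

Lemma ketbra_proj d (v : 'cV[R[i]]_d) : unit_vector v ->
  ketbra v *m ketbra v = ketbra v.
Proof. by move=> hv; rewrite /ketbra mulmxA -(mulmxA v) hv mulmx1. Qed.

Lemma ketbra_diag d (v : 'cV[R[i]]_d) x :
  ketbra v x x = (nsq (v x ord0))%:C.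
Proof. by rewrite !mxE big_ord1 adjmxE mulcJ. Qed.

Lemma mul_adjmx11 n (v : 'M[R[i]]_(1, n)) :
  v *m adjmx v = ((\sum_x nsq (v ord0 x))%:C)%:M.
Proof.
rewrite [LHS]mx11_scalar; congr (_%:M); rewrite !mxE rmorph_sum.
by apply: eq_bigr => x _; rewrite adjmxE mulcJ.
Qed.

Lemma quadratic_ketbra m d (A : 'M[R[i]]_(m, d)) (v : 'cV[R[i]]_d)
    (phi : 'cV[R[i]]_m) :
  adjmx phi *m (A *m ketbra v *m adjmx A) *m phi =
  ((nsq ((adjmx phi *m A *m v) ord0 ord0))%:C)%:M.
Proof.
transitivity ((adjmx phi *m A *m v) *m adjmx (adjmx phi *m A *m v)).
  by rewrite !adjmxM adjmxK /ketbra !mulmxA.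
by rewrite mul_adjmx11 big_ord1.
Qed.

Lemma psdmx_ketbra d (v : 'cV[R[i]]_d) : psdmx (ketbra v).
Proof.
split; first exact/hermP/ketbra_herm.
move=> w; have := quadratic_ketbra 1%:M v w.
rewrite mul1mx /adjmx trmx1 map_mx1 !mulmx1 => ->.
by rewrite !mxE mulr1n ler0c nsq_ge0.
Qed.

Lemma psdmx_conj m d (B : 'M[R[i]]_(m, d)) (X : 'M[R[i]]_d) :
  psdmx X -> psdmx (B *m X *m adjmx B).
Proof.
move=> [/hermP hX pX]; split.
  by apply/hermP; rewrite !adjmxM adjmxK hX mulmxA.
by move=> v; have := pX (adjmx B *m v); rewrite adjmxM adjmxK !mulmxA.
Qed.

Lemma psdmx_sum d (I : finType) (F : I -> 'M[R[i]]_d) :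
  (forall l, psdmx (F l)) -> psdmx (\sum_l F l).
Proof.
move=> hF; split.
  apply/hermP; rewrite /adjmx raddf_sum map_mx_sum.
  by apply: eq_bigr => l _; have [/hermP] := hF l.
move=> v; rewrite mulmx_sumr mulmx_suml summxE; apply: sumr_ge0 => l _.
exact: (hF l).2.
Qed.

Lemma unit_delta d (x : 'I_d) : unit_vector (delta_mx x ord0 : 'cV[R[i]]_d).
Proof.
apply/unit_vectorP; rewrite (bigD1 x) //= big1 => [|y /negbTE yx].
  by rewrite mxE !eqxx nsqC expr1n addr0.
by rewrite mxE yx nsqC expr0n.
Qed.

Lemma ketbra_delta d (x : 'I_d) :
  ketbra (delta_mx x ord0 : 'cV[R[i]]_d) = delta_mx x x.
Proof.
apply/matrixP => i j; rewrite !mxE big_ord1 adjmxE !mxE !eqxx !andbT.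
by rewrite conjcE conjc_nat -natrM mulnb.
Qed.

Lemma incoherent_delta d (x : 'I_d) :
  incoherent_state (delta_mx x x : 'M[R[i]]_d).
Proof.
split; last first.
  apply/is_diag_mxP => i j ij; rewrite mxE.
  by case: (i =P x) ij => // ->; case: (j =P x) => // ->; rewrite eqxx.
rewrite -ketbra_delta; split; first exact: psdmx_ketbra.
by rewrite trace_ketbra; have /unit_vectorP -> := unit_delta x.
Qed.

Lemma sum_mxtens_index (V : nmodType) (m n : nat) (F : 'I_(m * n) -> V) :
  \sum_k F k = \sum_i \sum_j F (mxtens_index (i, j)).
Proof.
rewrite -(sum_mxtens (fun i j => F (mxtens_index (i, j)))).
by apply: eq_bigr => k _; rewrite -[in LHS](mxtens_unindexK k).
Qed.

Lemma ampliation_kraus m n k r (K : 'I_r -> 'M[R[i]]_(n, m))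
    (X : 'M[R[i]]_(k * m)) :
  ampliation (fun X => \sum_l K l *m X *m adjmx (K l)) X =
  \sum_l tensmx (1%:M : 'M[R[i]]_k) (K l) *m X
    *m adjmx (tensmx (1%:M : 'M[R[i]]_k) (K l)).
Proof.
apply/matrixP => I J; case: (mxtens_indexP I) => a i.
case: (mxtens_indexP J) => b j; rewrite /ampliation !summxE.
under eq_bigr do rewrite summxE.
rewrite (bigD1 a) //= [X in _ + X]big1 ?addr0 => [|c /negbTE ca]; last first.
  by rewrite big1 // => b' _; rewrite tensmxE mxE eq_sym ca mul0r.
rewrite (bigD1 b) //= [X in _ + X]big1 ?addr0 => [|c /negbTE cb]; last first.
  by rewrite tensmxE mxE [b == c]eq_sym cb andbF mul0r.
rewrite tensmxE mxE !eqxx mul1r summxE; apply: eq_bigr => l _.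
rewrite !mxE [RHS]sum_mxtens_index (bigD1 b) //= [X in _ = _ + X]big1 ?addr0.
  apply: eq_bigr => j' _; rewrite !adjmxE tensmxE [1%:M b b]mxE eqxx mul1r.
  congr (_ * _); rewrite !mxE [RHS]sum_mxtens_index (bigD1 a) //=.
  rewrite [X in _ = _ + X]big1 ?addr0 => [|c /negbTE ca].
    by apply: eq_bigr => i' _; rewrite tensmxE !mxE eqxx mul1r.
  by apply: big1 => i' _; rewrite tensmxE !mxE eq_sym ca !mul0r.
move=> c /negbTE cb; apply: big1 => i' _.
by rewrite !adjmxE tensmxE [1%:M b c]mxE eq_sym cb mul0r rmorph0 mulr0.
Qed.

(** The second hypothesis says that each column of [K l] has at most one nonzero entry: basis
    vectors go to multiples of basis vectors, and diagonal matrices stay diagonal. *)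
Lemma kraus_incoherent_operation m n r (K : 'I_r -> 'M[R[i]]_(n, m)) :
  \sum_l adjmx (K l) *m K l = 1%:M ->
  (forall l x a b, a != b -> K l a x * Num.conj (K l b x) = 0) ->
  incoherent_operation (fun X => \sum_l K l *m X *m adjmx (K l)).
Proof.
move=> K1 Kinc; split.
- split=> [a X Y|k X pX].
    rewrite scaler_sumr -big_split /=; apply: eq_bigr => l _.
    by rewrite mulmxDr mulmxDl -scalemxAr -scalemxAl.
  rewrite ampliation_kraus; apply: psdmx_sum => l; exact: psdmx_conj.
- move=> X; rewrite raddf_sum /=.
  transitivity (\tr ((\sum_l adjmx (K l) *m K l) *m X)).
    rewrite mulmx_suml raddf_sum; apply: eq_bigr => l _.
    by rewrite mxtrace_mulC mulmxA.
  by rewrite K1 mul1mx.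
- exists r, K; split=> // l rho [_ /is_diag_mxP rhoD].
  apply/is_diag_mxP => a b ab; rewrite mxE big1 // => x _.
  rewrite mxE (bigD1 x) //= big1 ?addr0 => [|y yx].
    by rewrite adjmxE mulrAC Kinc ?mul0r.
  by rewrite rhoD ?mulr0.
Qed.

Lemma sqrtmx_scale_ketbra d (c : R) (phi : 'cV[R[i]]_d) : unit_vector phi ->
  sqrtmx (c%:C *: ketbra phi) = (Num.sqrt c)%:C *: ketbra phi.
Proof.
move=> hphi; apply: mxfun_scale_proj; first exact: sqrtr0.
  exact: ketbra_herm.
exact: ketbra_proj.
Qed.

(** A rank-one projector is its own square root, so the operator under the outer root is [c] times a
    projector, and its root has trace sqrt c. *)
Lemma fidelity_pure d (X : 'M[R[i]]_d) (phi : 'cV[R[i]]_d) (c : R) :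
  unit_vector phi -> 0 <= c -> adjmx phi *m X *m phi = c%:C%:M ->
  fidelity X (ketbra phi) ^+ 2 = c.
Proof.
move=> hphi c0 hc; rewrite /fidelity.
have -> : sqrtmx (ketbra phi) = ketbra phi.
  by have := sqrtmx_scale_ketbra 1 hphi; rewrite sqrtr1 scale1r.
have -> : ketbra phi *m X *m ketbra phi = c%:C *: ketbra phi.
  transitivity (phi *m (adjmx phi *m X *m phi) *m adjmx phi).
    by rewrite /ketbra !mulmxA.
  by rewrite hc mul_mx_scalar -scalemxAl.
rewrite sqrtmx_scale_ketbra // mxtraceZ trace_ketbra.
have /unit_vectorP -> := hphi.
by rewrite mulr1 /= sqr_sqrtr.
Qed.

Lemma unit_max_coherent M : (0 < M)%N -> unit_vector (max_coherent R M).
Proof.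
move=> M0; apply/unit_vectorP.
under eq_bigr do rewrite mxE nsqC exprVn sqr_sqrtr ?ler0n //.
by rewrite sumr_const card_ord -[LHS]mulr_natr mulVf // pnatr_eq0 -lt0n.
Qed.

Lemma adj_max_coherent_mul M n (A : 'M[R[i]]_(M, n)) x :
  (adjmx (max_coherent R M) *m A) ord0 x =
  ((Num.sqrt M%:R)^-1)%:C * \sum_a A a x.
Proof.
rewrite mxE mulr_sumr; apply: eq_bigr => a _.
by rewrite adjmxE mxE conjcE conjc_real.
Qed.

End States.

Section Entropy.
Variable R : realType.

Lemma dephaseE d (X : 'M[R[i]]_d) : dephase X = diag_mx (\row_x X x x).
Proof.
apply/matrixP => i j; rewrite !mxE summxE (bigD1 i) //= big1 => [|k ki].
  rewrite addr0 mxE (bigD1 i) //= big1 => [|k ki]; rewrite !mxE; last first.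
    by rewrite (negbTE ki) mulr0.
  rewrite addr0 (bigD1 i) //= big1 => [|k ki]; rewrite !mxE; last first.
    by rewrite (negbTE ki) andbF mul0r.
  by rewrite !eqxx addr0 mul1r mulr_natr eq_sym.
rewrite mxE big1 // => l _; rewrite mxE big1 ?mul0r // => l' _.
by rewrite mxE eq_sym (negbTE ki) mul0r.
Qed.

Lemma entropy_dephase_ketbra d (v : 'cV[R[i]]_d) :
  entropy (dephase (ketbra v)) = shannon (fun x => nsq (v x ord0)) / ln 2.
Proof.
rewrite /entropy dephaseE.
have -> : \row_x ketbra v x x = \row_x (nsq (v x ord0))%:C.
  by apply/rowP => x; rewrite !mxE -ketbra_diag !mxE.
rewrite mxfun_diag mulmx_diag mxtrace_diag Re_sum /shannon mulNr mulr_suml.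
congr (- _); apply: eq_bigr => x _.
by rewrite !mxE Re_scale /log2 mulrA.
Qed.

End Entropy.

(** * Overlap with the maximally coherent state *)

Section Overlap.
Variable R : rcfType.

Lemma kraus_overlap m M r (K : 'I_r -> 'M[R[i]]_(M, m)) (w : 'cV[R[i]]_m)
    (phi : 'cV[R[i]]_M) :
  adjmx phi *m (\sum_l K l *m ketbra w *m adjmx (K l)) *m phi =
  ((\sum_l nsq ((adjmx phi *m K l *m w) ord0 ord0))%:C)%:M.
Proof.
rewrite mulmx_sumr mulmx_suml !raddf_sum /=; apply: eq_bigr => l _.
exact: quadratic_ketbra.
Qed.

(** The product is an off-diagonal entry of the image of the basis state at [x]. *)
Lemma incoherent_kraus_col m M (K : 'M[R[i]]_(M, m)) x a b :
  (forall rho, incoherent_state rho -> is_diag_mx (K *m rho *m adjmx K)) ->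
  a != b -> K a x * Num.conj (K b x) = 0.
Proof.
move=> /(_ _ (incoherent_delta R x)) /is_diag_mxP h /h <-.
rewrite -ketbra_delta -mulmxA /ketbra -[in RHS]mulmxA -adjmxM mulmxA.
by rewrite -colE !mxE big_ord1 adjmxE !mxE.
Qed.

Lemma nsq_incoherent_sum M (v : 'I_M -> R[i]) :
  (forall a b, a != b -> v a * Num.conj (v b) = 0) ->
  nsq (\sum_a v a) = \sum_a nsq (v a).
Proof.
move=> h; apply: complexI; rewrite -mulcJ rmorph_sum rmorph_sum mulr_suml /=.
apply: eq_bigr => a _; rewrite mulr_sumr (bigD1 a) //= mulcJ.
by rewrite big1 ?addr0 // => b ba; rewrite h // eq_sym.
Qed.

Lemma kraus_trace m M r (K : 'I_r -> 'M[R[i]]_(M, m)) (w : 'cV[R[i]]_m) :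
  \tr (\sum_l K l *m ketbra w *m adjmx (K l)) =
  (\sum_l \sum_a nsq ((K l *m w) a ord0))%:C.
Proof.
rewrite raddf_sum rmorph_sum; apply: eq_bigr => l _ /=.
rewrite -trace_ketbra; congr (\tr _).
by rewrite /ketbra adjmxM !mulmxA.
Qed.

Lemma sum_mask (I : finType) (T : pred I) (F G : I -> R[i]) :
  \sum_i F i * (if T i then G i else 0) = \sum_(i | T i) F i * G i.
Proof.
by rewrite [RHS]big_mkcond; apply: eq_bigr => i _; case: ifP; rewrite ?mulr0.
Qed.

(** Splitting [w] into its parts on and off [T] costs the factor 2. The part off [T] has overlap at
    most its trace. On [T], Cauchy-Schwarz leaves the overlaps of the images of the basis vectors in
    [T]; each equals 1 / M, because a column of a Kraus operator has at most one nonzero entry. *)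
Lemma incoherent_overlap_le m M (Lambda : 'M[R[i]]_m -> 'M[R[i]]_M)
    (w : 'cV[R[i]]_m) (T : pred 'I_m) : (0 < M)%N ->
  incoherent_operation Lambda -> unit_vector w ->
  exists c, [/\ 0 <= c,
    adjmx (max_coherent R M) *m Lambda (ketbra w) *m max_coherent R M
      = c%:C%:M
  & c <= 2 * (#|T|%:R / M%:R + \sum_(x | ~~ T x) nsq (w x ord0))].
Proof.
move=> M0 [_ tp [r [K [LK Kinc]]]] /unit_vectorP w1.
set phi := max_coherent R M.
have phi1 : \sum_a nsq (adjmx phi ord0 a) = 1.
  have /unit_vectorP <- := unit_max_coherent R M0.
  by apply: eq_bigr => a _; rewrite adjmxE nsqJ.
have tr (v : 'cV[R[i]]_m) :
    \sum_l \sum_a nsq ((K l *m v) a ord0) = \sum_x nsq (v x ord0).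
  by apply: complexI; rewrite -kraus_trace -LK tp trace_ketbra.
exists (\sum_l nsq ((adjmx phi *m K l *m w) ord0 ord0)); split.
- by apply: sumr_ge0 => l _; apply: nsq_ge0.
- by rewrite LK kraus_overlap.
pose cut (S : pred 'I_m) : 'cV[R[i]]_m :=
  \col_x (if S x then w x ord0 else 0).
pose z S l := (adjmx phi *m K l *m cut S) ord0 ord0.
have wE : w = cut T + cut (predC T).
  apply/colP => x; rewrite !mxE /=.
  by case: (T x); rewrite ?addr0 ?add0r.
have -> : \sum_l nsq ((adjmx phi *m K l *m w) ord0 ord0)
    = \sum_l nsq (z T l + z (predC T) l).
  by apply: eq_bigr => l _; rewrite {1}wE mulmxDr mxE.
apply: le_trans
  (_ : 2 * (\sum_l nsq (z T l) + \sum_l nsq (z (predC T) l)) <= _).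
  rewrite -big_split mulr_sumr; apply: ler_sum => l _; exact: nsqD_le.
rewrite ler_pM2l ?ltr0n // lerD //; last first.
  apply: le_trans (_ : \sum_l \sum_a nsq ((K l *m cut (predC T)) a ord0) <= _).
    apply: ler_sum => l _; rewrite /z -mulmxA mxE.
    apply: le_trans (nsq_sum_mul_le _ _ _) _.
    by rewrite phi1 mul1r.
  rewrite tr [leRHS]big_mkcond /=; apply: ler_sum => x _; rewrite mxE /=.
  by case: (T x); rewrite /= ?nsqC ?expr0n.
apply: le_trans
  (_ : \sum_l \sum_(x | T x) nsq ((adjmx phi *m K l) ord0 x) <= _).
  apply: ler_sum => l _; rewrite /z mxE.
  under eq_bigr do rewrite [cut T _ _]mxE.
  rewrite sum_mask; apply: le_trans (nsq_sum_mul_le _ _ _) _.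
  rewrite -[leRHS]mulr1 ler_wpM2l //.
    by apply: sumr_ge0 => x _; apply: nsq_ge0.
  rewrite -w1 [leRHS](bigID T) /= lerDl.
  by apply: sumr_ge0 => x _; apply: nsq_ge0.
rewrite exchange_big /= mulr_natl -sumr_const.
apply: ler_sum => x _.
(* Trace preservation at the basis vector [x]: the squared entries of column [x], over all Kraus
   operators, add up to 1. *)
have := tr (delta_mx x ord0); have /unit_vectorP -> := unit_delta R x => h.
rewrite -[leRHS]mul1r -[X in _ <= X * _]h mulr_suml; apply: ler_sum => l _.
rewrite adj_max_coherent_mul nsqM nsqC exprVn sqr_sqrtr ?ler0n //.
rewrite nsq_incoherent_sum => [|a b ab]; last first.
  exact: incoherent_kraus_col (Kinc l) ab.
rewrite mulrC ler_wpM2r ?invr_ge0 ?ler0n //; apply: ler_sum => a _.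
by rewrite -colE mxE.
Qed.

(** [K r] selects the r-th block of ranks, sends rank k to k mod M and removes the phase. The
    overlap is the sum over blocks of (sum of |w|)^2 / M, which [block_sum] bounds from below; [B]
    is the first block. *)
Lemma incoherent_overlap_ge m M (w : 'cV[R[i]]_m) : (0 < M)%N ->
  unit_vector w ->
  exists (Lambda : 'M[R[i]]_m -> 'M[R[i]]_M) (c : R) (B : pred 'I_m),
  [/\ incoherent_operation Lambda, 0 <= c,
    adjmx (max_coherent R M) *m Lambda (ketbra w) *m max_coherent R M
      = c%:C%:M,
    (#|B| <= M)%N
  & 1 - \sum_(x | B x) nsq (w x ord0) <= c].
Proof.
move=> M0 /unit_vectorP w1; set phi := max_coherent R M.
pose b x := Num.sqrt (nsq (w x ord0)).
have b2 x : b x ^+ 2 = nsq (w x ord0) by rewrite sqr_sqrtr ?nsq_ge0.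
have b0 x : 0 <= b x by apply: sqrtr_ge0.
have [rk rkI rkb] := block_sum M0 b0.
(* Where the amplitude vanishes the phase is set to 1, so that the Kraus operators still satisfy
   [K1]. *)
pose u x : R[i] := if w x ord0 == 0 then 1
  else Num.conj (w x ord0) * ((b x)^-1)%:C.
have bn0 x : w x ord0 != 0 -> b x != 0.
  by rewrite -[b x == 0]sqrf_eq0 b2 nsq_eq0.
have u1 x : nsq (u x) = 1.
  rewrite /u; case: eqVneq => [_|w0]; first by rewrite nsqC expr1n.
  by rewrite nsqM nsqJ nsqC -b2 exprVn divff ?expf_neq0 ?bn0.
have uw x : u x * w x ord0 = (b x)%:C.
  rewrite /u; case: eqVneq => [w0|w0].
    by rewrite /b w0 nsqC expr0n sqrtr0 mulr0.
  rewrite mulrAC [Num.conj _ * _]mulrC mulcJ -b2 -rmorphM; congr (_%:C).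
  by rewrite expr2 mulfK ?bn0.
(* There are at most [m] blocks, so ['I_m] indexes all of them; [K r = 0] for an empty block. *)
pose K (r : 'I_m) : 'M[R[i]]_(M, m) := \matrix_(a, x)
  (if ((rk x %/ M)%N == r) && ((rk x %% M)%N == a) then u x else 0).
have K1 : \sum_r adjmx (K r) *m K r = 1%:M.
  apply/matrixP => x y; rewrite summxE mxE.
  have lt : (rk x %/ M < m)%N by apply: leq_ltn_trans (leq_div _ _) _.
  have ltM : (rk x %% M < M)%N by rewrite ltn_pmod.
  rewrite (bigD1 (Ordinal lt)) //= [X in _ + X]big1 ?addr0; last first.
    move=> r; rewrite -val_eqE /= eq_sym => /negbTE rx.
    by rewrite mxE big1 // => a _; rewrite adjmxE !mxE rx rmorph0 mul0r.
  rewrite mxE (bigD1 (Ordinal ltM)) //= [X in _ + X]big1 ?addr0; last first.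
    move=> a; rewrite -val_eqE /= eq_sym => /negbTE ax.
    by rewrite adjmxE !mxE ax andbF rmorph0 mul0r.
  rewrite adjmxE !mxE !eqxx /=.
  have [->|xy] := eqVneq x y; first by rewrite !eqxx /= mulrC mulcJ u1.
  case: ifP => [/andP[/eqP e1 /eqP e2]|_]; last by rewrite mulr0.
  case/eqP: xy; apply/rkI/val_inj => /=.
  by rewrite (divn_eq (rk x) M) (divn_eq (rk y) M) e1 e2.
have Kinc l x a a' : a != a' -> K l a x * Num.conj (K l a' x) = 0.
  move=> aa; rewrite !mxE.
  case: ifP => [/andP[_ /eqP e1]|_]; last by rewrite mul0r.
  case: ifP => [/andP[_ /eqP e]|_]; last by rewrite rmorph0 mulr0.
  by case/eqP: aa; apply: val_inj; rewrite /= -e1.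
exists (fun X => \sum_l K l *m X *m adjmx (K l)).
exists (\sum_l nsq ((adjmx phi *m K l *m w) ord0 ord0)).
exists [pred x | (rk x < M)%N]; split.
- exact: kraus_incoherent_operation.
- by apply: sumr_ge0 => l _; apply: nsq_ge0.
- exact: kraus_overlap.
- apply: leq_trans (card_block M0 0%N rkI).
  by apply/subset_leq_card/fintype.subsetP => x; rewrite !inE => /divn_small ->.
rewrite -w1 -(eq_bigr _ (fun x _ => b2 x)) -(eq_bigr _ (fun x _ => b2 x)).
apply: le_trans rkb _; apply: ler_sum => r _.
have -> : (adjmx phi *m K r *m w) ord0 ord0 =
    ((Num.sqrt M%:R)^-1 * \sum_(x | (rk x %/ M)%N == r) b x)%:C.
  rewrite mxE rmorphM rmorph_sum mulr_sumr [RHS]big_mkcond /=.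
  apply: eq_bigr => x _; rewrite adj_max_coherent_mul -mulrA; case: ifP => rx.
    rewrite -uw; congr (_ * (_ * _)).
    have ltM : (rk x %% M < M)%N by rewrite ltn_pmod.
    rewrite (bigD1 (Ordinal ltM)) //= [X in _ + X]big1 ?addr0; last first.
      move=> a; rewrite -val_eqE /= eq_sym => /negbTE ax.
      by rewrite !mxE ax andbF.
    by rewrite !mxE rx eqxx.
  by rewrite big1 ?mul0r ?mulr0 // => a _; rewrite !mxE rx.
by rewrite nsqC exprMn exprVn sqr_sqrtr ?ler0n // mulrC.
Qed.

End Overlap.

Definition diagp (R : rcfType) (d : nat) (A : 'M[R[i]]_d) (x : 'I_d) : R :=
  complex.Re (A x x).

Section Density.
Variables (R : rcfType) (d : nat).

Lemma psdmx_diag_ge0 (A : 'M[R[i]]_d) x : psdmx A -> 0 <= A x x.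
Proof.
pose v : 'cV[R[i]]_d := delta_mx x ord0; move=> [_ /(_ v)].
suff -> : (adjmx v *m A *m v) ord0 ord0 = A x x by [].
rewrite -colE mxE (_ : adjmx _ = delta_mx ord0 x) -?rowE ?mxE //.
apply/matrixP => i j; rewrite adjmxE !mxE conjcE conjc_nat.
by rewrite andbC.
Qed.

Lemma ge0_ReE (z : R[i]) : 0 <= z -> z = (complex.Re z)%:C.
Proof. by case: z => a b; rewrite lecE /= => /andP[/eqP -> _]. Qed.

Lemma density_diagE (A : 'M[R[i]]_d) x : density A -> A x x = (diagp A x)%:C.
Proof. by move=> [/(psdmx_diag_ge0 x) /ge0_ReE]. Qed.

End Density.

Lemma probvec_diagp (R : realType) d (A : 'M[R[i]]_d) :
  density A -> probvec (diagp A).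
Proof.
move=> hA; split.
  move=> x; have := psdmx_diag_ge0 x hA.1.
  by rewrite density_diagE // ler0c.
apply: complexI; rewrite rmorph_sum rmorph1 -hA.2; apply: eq_bigr => x _.
by rewrite density_diagE.
Qed.

(** * The random-sign ensemble of a state *)

Section SignEnsemble.
Variables (R : realType) (d : nat) (sigma : 'M[R[i]]_d).
Hypothesis hs : density sigma.

Let S := spectralmx sigma.
Let l : 'I_d -> R := fun k => complex.Re (spectral_diag sigma ord0 k).
Let D : 'M[R[i]]_d := diag_mx (\row_k (Num.sqrt (l k))%:C).
Let A : 'M[R[i]]_d := adjmx S *m D.

Let adjS : S *m adjmx S = 1%:M.
Proof. exact/unitarymxP/spectral_unitarymx. Qed.

Let sigmaE : sigma = adjmx S *m diag_mx (spectral_diag sigma) *m S.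
Proof.
have [[/hermitian_normalmx /orthomx_spectralP h _] _] := hs.
by rewrite {1}h invmx_unitary ?spectral_unitarymx.
Qed.

Let diagE : S *m sigma *m adjmx S = diag_mx (spectral_diag sigma).
Proof.
by rewrite {1}sigmaE !mulmxA adjS mul1mx -mulmxA adjS mulmx1.
Qed.

Let spectral_ge0 k : 0 <= spectral_diag sigma ord0 k.
Proof.
have := psdmx_diag_ge0 k (psdmx_conj S hs.1).
by rewrite diagE mxE eqxx mulr1n.
Qed.

Let lE k : spectral_diag sigma ord0 k = (l k)%:C.
Proof. exact: ge0_ReE. Qed.

Let l_ge0 k : 0 <= l k.
Proof. by rewrite -ler0c -lE. Qed.

Let DD : D *m D = diag_mx (spectral_diag sigma).
Proof.
rewrite mulmx_diag; congr diag_mx; apply/rowP => k.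
by rewrite !mxE -rmorphM -expr2 sqr_sqrtr // lE.
Qed.

Let adjD : adjmx D = D.
Proof.
apply/matrixP => i j; rewrite adjmxE !mxE.
have [->|ij] := eqVneq i j; first by rewrite !mulr1n conjcE conjc_real.
by rewrite !mulr0n rmorph0.
Qed.

Let AAt : A *m adjmx A = sigma.
Proof.
by rewrite /A adjmxM adjmxK adjD mulmxA -(mulmxA (adjmx S)) DD.
Qed.

Let AtA : adjmx A *m A = diag_mx (spectral_diag sigma).
Proof.
by rewrite /A adjmxM adjmxK adjD mulmxA -(mulmxA D) adjS mulmx1 DD.
Qed.

Lemma density_factor : exists C : 'M[R[i]]_d, C *m adjmx C = sigma.
Proof. by exists A. Qed.

Let sum_l : \sum_k l k = 1.
Proof.
apply: complexI; rewrite rmorph_sum rmorph1 -hs.2 -AAt mxtrace_mulC.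
rewrite AtA mxtrace_diag.
by apply: eq_bigr => k _; rewrite lE.
Qed.

Let sgv (e : {ffun 'I_d -> bool}) : 'cV[R[i]]_d := \col_k sg R[i] e k.

Let sgC (e : {ffun 'I_d -> bool}) k : sg R[i] e k = (sg R e k)%:C.
Proof. by rewrite /sg rmorphXn rmorphN1. Qed.

(** As [adjmx A *m A] is diagonal, the squared norm is the sum of the eigenvalues, whatever the
    signs. *)
Let unit_ket e : unit_vector (A *m sgv e).
Proof.
rewrite /unit_vector adjmxM -mulmxA (mulmxA (adjmx A)) AtA [LHS]mx11_scalar.
congr (_%:M); rewrite mxE -[RHS](rmorph1 (real_complex R)) -sum_l rmorph_sum.
apply: eq_bigr => k _; rewrite adjmxE mul_diag_mx !mxE lE sgC mulrCA.
by rewrite [X in _ * X]mulrC mulcJ nsqC sqrr_sign mulr1.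
Qed.

Let p0 : 0 < (2 ^ d)%:R^-1 :> R.
Proof. by rewrite invr_gt0 ltr0n expn_gt0. Qed.

Let sum_enum (V : nmodType) (F : {ffun 'I_d -> bool} -> V) :
  \sum_(s < #|{ffun 'I_d -> bool}|) F (enum_val s) = \sum_e F e.
Proof. by rewrite -big_enum_val. Qed.

Let prob_sum :
  \sum_(s < #|{ffun 'I_d -> bool}|) (2 ^ d)%:R^-1 = 1 :> R.
Proof.
rewrite sumr_const card_ord card_ffun card_bool card_ord.
by rewrite -[LHS]mulr_natr mulVf // pnatr_eq0 -lt0n expn_gt0.
Qed.

Definition sign_ensemble : ensemble R d :=
  @Ensemble R d _ (fun=> (2 ^ d)%:R^-1)
    (fun s => A *m sgv (enum_val s)) (fun=> p0) prob_sum
    (fun s => unit_ket (enum_val s)).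

(** Distinct signs are uncorrelated, so the average of [ketbra (sgv e)] is the identity. *)
Lemma sign_ensemble_density : ens_density sign_ensemble = sigma.
Proof.
rewrite /ens_density /=.
rewrite (sum_enum (fun e => ((2 ^ d)%:R^-1)%:C *: ketbra (A *m sgv e))).
rewrite -[RHS]AAt -[X in X *m _]mulmx1.
transitivity (A *m (\sum_e ((2 ^ d)%:R^-1)%:C *: ketbra (sgv e)) *m adjmx A).
  rewrite mulmx_sumr mulmx_suml; apply: eq_bigr => e _.
  by rewrite -scalemxAr -scalemxAl /ketbra adjmxM !mulmxA.
congr (_ *m _ *m _); apply/matrixP => i j; rewrite summxE.
transitivity (((2 ^ d)%:R^-1)%:C * \sum_e sg R[i] e i * sg R[i] e j).
  rewrite mulr_sumr; apply: eq_bigr => e _.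
  by rewrite !mxE big_ord1 adjmxE !mxE !sgC conjcE conjc_real.
rewrite sum_sg_sg mulrA mxE fmorphV rmorph_nat mulVf ?mul1r //.
Qed.

(** The amplitude at [x] is a signed sum of row [x] of [A], whose squared norm is [diagp sigma x];
    the fourth-moment bound applies to it. *)
Lemma sign_ensemble_moment x :
  \sum_s ens_prob sign_ensemble s * nsq (ens_ket sign_ensemble s x ord0) ^+ 2
  <= 3 * diagp sigma x ^+ 2.
Proof.
rewrite /= (sum_enum (fun e => (2 ^ d)%:R^-1 * nsq ((A *m sgv e) x ord0) ^+ 2)).
rewrite -mulr_sumr mulrC ler_pdivrMr ?ltr0n ?expn_gt0 // mulrC.
have -> : diagp sigma x =
    \sum_k (complex.Re (A x k) ^+ 2 + complex.Im (A x k) ^+ 2).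
  apply: complexI; rewrite -density_diagE // -AAt mxE rmorph_sum.
  by apply: eq_bigr => k _; rewrite adjmxE mulcJ.
apply: le_trans (sum_sg_fourth_moment _ _); apply: ler_sum => e _.
rewrite mxE (_ : nsq _ =
  (\sum_k sg R e k * complex.Re (A x k)) ^+ 2
  + (\sum_k sg R e k * complex.Im (A x k)) ^+ 2) //.
rewrite /nsq; congr (_ ^+ 2 + _ ^+ 2).
  rewrite Re_sum; apply: eq_bigr => k _.
  by rewrite [sgv e k _]mxE sgC mulrC Re_scale.
rewrite (raddf_sum (@complex.Im R : Rcomplex R -> R)); apply: eq_bigr => k _.
rewrite [sgv e k _]mxE sgC; case: (A x k) => a b /=.
by rewrite mulr0 add0r mulrC.
Qed.

End SignEnsemble.

Local Open Scope classical_set_scope.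

(** * One-shot bounds *)

Definition ens_diag (R : realType) (d : nat) (E : ensemble R d)
    (s : 'I_(ens_size E)) (x : 'I_d) : R := nsq (ens_ket E s x ord0).

Arguments ens_diag {R d} E s x.

(** The supremum of the empty set is 0, so [0 <= B] replaces a proof that [S] is nonempty. *)
Lemma sup_le_ge0 (R : realType) (S : set R) (B : R) :
  0 <= B -> (forall x, S x -> x <= B) -> sup S <= B.
Proof.
move=> B0 hB; have [->|/set0P S0] := eqVneq S set0; first by rewrite sup0.
exact: ge_sup.
Qed.

Section Ensemble.
Variables (R : realType) (d : nat) (E : ensemble R d).

Lemma ens_diag_ge0 s x : 0 <= ens_diag E s x.
Proof. exact: nsq_ge0. Qed.

Lemma ens_average x :
  \sum_s ens_prob E s * ens_diag E s x = diagp (ens_density E) x.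
Proof.
rewrite /diagp summxE Re_sum; apply: eq_bigr => s _.
by rewrite mxE Re_scale ketbra_diag.
Qed.

Lemma ens_diag_eq0 s x : diagp (ens_density E) x = 0 -> ens_diag E s x = 0.
Proof.
rewrite -ens_average => /eqP; rewrite psumr_eq0 => [|t _]; last first.
  by rewrite mulr_ge0 ?ens_diag_ge0 // ltW ?ens_prob_gt0.
move=> /allP/(_ s (mem_index_enum s)) /=.
by rewrite mulf_eq0 gt_eqF ?ens_prob_gt0 //= => /eqP.
Qed.

Lemma ens_exchange (T : pred 'I_d) :
  \sum_s ens_prob E s * (\sum_(x | T x) ens_diag E s x) =
  \sum_(x | T x) diagp (ens_density E) x.
Proof.
under eq_bigr do rewrite mulr_sumr.
by rewrite exchange_big; apply: eq_bigr => x _; rewrite /= -ens_average.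
Qed.

(** The target is pure, so the squared fidelity is linear in the state. *)
Lemma ens_fidelity M (Lambda : 'I_(ens_size E) -> 'M[R[i]]_d -> 'M[R[i]]_M)
    (c : 'I_(ens_size E) -> R) : (0 < M)%N -> (forall s, 0 <= c s) ->
  (forall s, adjmx (max_coherent R M) *m Lambda s (ketbra (ens_ket E s))
     *m max_coherent R M = (c s)%:C%:M) ->
  fidelity (\sum_s (ens_prob E s)%:C *: Lambda s (ketbra (ens_ket E s)))
    (ketbra (max_coherent R M)) ^+ 2 = \sum_s ens_prob E s * c s.
Proof.
move=> M0 c0 hc; apply: fidelity_pure.
- exact: unit_max_coherent.
- by apply: sumr_ge0 => s _; rewrite mulr_ge0 // ltW ?ens_prob_gt0.
rewrite mulmx_sumr mulmx_suml !raddf_sum /=; apply: eq_bigr => s _.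
by rewrite -scalemxAr -scalemxAl hc rmorphM /= scale_scalar_mx.
Qed.

Definition distill_values M : set R :=
  [set x | exists Lambda : 'I_(ens_size E) -> 'M[R[i]]_d -> 'M[R[i]]_M,
     (forall s, incoherent_operation (Lambda s)) /\
     x = fidelity
           (\sum_s (ens_prob E s)%:C *: Lambda s (ketbra (ens_ket E s)))
           (ketbra (max_coherent R M)) ^+ 2].

Lemma distill_values_le M (T : pred 'I_d) x : (0 < M)%N ->
  distill_values M x -> x <= 2 * (#|T|%:R / M%:R
    + \sum_(x | ~~ T x) diagp (ens_density E) x).
Proof.
move=> M0 [Lambda [hL ->]].
have hc s := incoherent_overlap_le T M0 (hL s) (ens_ket_unit s).
pose c s := sval (cid (hc s)).
have c0 s : 0 <= c s by rewrite /c; case: cid => ? [].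
rewrite (ens_fidelity (c := c)) //; last first.
  by move=> s; rewrite /c; case: cid => ? [].
rewrite -ens_exchange -[_ / _]mul1r -[X in X * (_ / _)](ens_prob_sum E).
rewrite mulr_suml -big_split /=.
rewrite mulr_sumr; apply: ler_sum => s _.
rewrite -mulrDr mulrCA ler_wpM2l ?(ltW (ens_prob_gt0 s)) //.
by rewrite /c; case: cid => ? [].
Qed.

Lemma distill_fidelity2_le M (T : pred 'I_d) : (0 < M)%N ->
  (forall x, 0 <= diagp (ens_density E) x) ->
  distill_fidelity2 E M <= 2 * (#|T|%:R / M%:R
    + \sum_(x | ~~ T x) diagp (ens_density E) x).
Proof.
move=> M0 P0; apply: sup_le_ge0 => [|x]; last exact: distill_values_le.
by rewrite mulr_ge0 // addr_ge0 ?divr_ge0 ?ler0n // sumr_ge0.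
Qed.

Lemma distill_fidelity2_ge M : (0 < M)%N ->
  exists B : 'I_(ens_size E) -> pred 'I_d,
  (forall s, (#|B s| <= M)%N) /\
  1 - \sum_s ens_prob E s * (\sum_(x | B s x) ens_diag E s x)
    <= distill_fidelity2 E M.
Proof.
move=> M0.
have h (s : 'I_(ens_size E)) := incoherent_overlap_ge M0 (ens_ket_unit s).
pose L s := sval (cid (h s)).
have hL s := svalP (cid (h s)).
pose c s := sval (cid (hL s)).
have hc s := svalP (cid (hL s)).
pose B s := sval (cid (hc s)).
have hB s := svalP (cid (hc s)).
exists B; split; first by move=> s; case: (hB s).
apply: (@le_trans _ _ (\sum_s ens_prob E s * c s)).
  rewrite -[X in X - _](ens_prob_sum E) -sumrB; apply: ler_sum => s _.
  rewrite -{1}[ens_prob E s]mulr1 -mulrBr ler_wpM2l ?(ltW (ens_prob_gt0 s)) //.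
  by case: (hB s).
apply: ub_le_sup.
  (* Only boundedness of the set matters here; the bound with [T] the whole basis provides it. *)
  exists (2 * (#|@predT 'I_d|%:R / M%:R
    + \sum_(x | ~~ predT x) diagp (ens_density E) x)).
  by move=> x; apply: distill_values_le.
exists L; split; first by move=> s; case: (hB s).
rewrite (ens_fidelity (c := c)) // => s; by case: (hB s).
Qed.

Lemma mean_entropyE :
  \sum_s ens_prob E s * entropy (dephase (ketbra (ens_ket E s))) =
  - (\sum_x \sum_s ens_prob E s * (ens_diag E s x * ln (ens_diag E s x)))
    / ln 2.
Proof.
rewrite exchange_big /= -sumrN mulr_suml; apply: eq_bigr => s _.
by rewrite entropy_dephase_ketbra /shannon mulrA mulrN mulr_sumr.
Qed.

(** At each basis index, the tangent of q ln q at P(x) averages to P ln P, because Q(x) has mean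
    P(x). *)
Lemma mean_entropy_le : density (ens_density E) ->
  \sum_s ens_prob E s * entropy (dephase (ketbra (ens_ket E s))) <=
  shannon (diagp (ens_density E)) / ln 2.
Proof.
move=> hs; have [P0 P1] := probvec_diagp hs.
rewrite mean_entropyE ler_pM2r ?invr_gt0 ?ln_gt0 ?ltr1n // lerN2.
apply: ler_sum => x _; set P := diagp _ x.
apply: (@le_trans _ _ (\sum_s ens_prob E s *
    (ens_diag E s x * ln P + ens_diag E s x - P))).
  rewrite (eq_bigr (fun s => ens_prob E s * ens_diag E s x * (ln P + 1)
      - ens_prob E s * P)); last by move=> s _; ring.
  rewrite sumrB -!mulr_suml ens_average ens_prob_sum -/P; lra.
apply: ler_sum => s _; rewrite ler_wpM2l ?(ltW (ens_prob_gt0 s)) //.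
by apply: mul_ln_ge; rewrite ?ens_diag_ge0 ?P0 //; apply: ens_diag_eq0.
Qed.

End Ensemble.

Section SecondMoment.
Variables (R : realType) (d : nat) (E : ensemble R d).
Hypothesis hs : density (ens_density E).
Hypothesis hm : forall x,
  \sum_s ens_prob E s * ens_diag E s x ^+ 2 <= 3 * diagp (ens_density E) x ^+ 2.

(** Take c = 3 P(x) in [mul_ln_le]: the second moment contributes at most 3 P^2 / (3 P) = P, which
    the mean of the term - Q cancels. So Q ln Q has mean at most P ln(3 P), and the factor 3 costs
    ln 3 in total. *)
Lemma mean_entropy_ge :
  (shannon (diagp (ens_density E)) - ln 3) / ln 2 <=
  \sum_s ens_prob E s * entropy (dephase (ketbra (ens_ket E s))).
Proof.
have [P0 P1] := probvec_diagp hs.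
rewrite mean_entropyE ler_pM2r ?invr_gt0 ?ln_gt0 ?ltr1n //.
rewrite -opprD lerN2 -[ln 3]mul1r -[X in X * ln 3]P1 mulr_suml -big_split /=.
apply: ler_sum => x _; have := hm x; have := @ens_diag_eq0 _ _ E ^~ x.
have := ens_average E x; have := P0 x; set P := diagp _ x => Px0 avg z m.
have [Pz|Pn0] := eqVneq P 0.
  rewrite Pz !mul0r addr0 big1 // => s _.
  by rewrite z ?mul0r ?mulr0.
have Pp : 0 < P by rewrite lt0r Pn0.
apply: (@le_trans _ _ (\sum_s ens_prob E s * (ens_diag E s x * ln (3 * P)
    + ens_diag E s x ^+ 2 / (3 * P) - ens_diag E s x))).
  apply: ler_sum => s _; rewrite ler_wpM2l ?(ltW (ens_prob_gt0 s)) //.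
  by apply: mul_ln_le; rewrite ?ens_diag_ge0 ?mulr_gt0.
rewrite (eq_bigr (fun s => ens_prob E s * ens_diag E s x * (ln (3 * P) - 1)
  + ens_prob E s * ens_diag E s x ^+ 2 / (3 * P))); last first.
  by move=> s _; ring.
rewrite big_split /= -!mulr_suml avg lnM ?posrE //.
have : (\sum_s ens_prob E s * ens_diag E s x ^+ 2) / (3 * P) <= P.
  rewrite ler_pdivrMr ?mulr_gt0 //; apply: le_trans m _; lra.
lra.
Qed.

(* [Q <= t + Q^2 / t] bounds the mass of a set of at most [M] points, whichever
   way the set depends on the member of the ensemble. *)
Lemma mean_mass_le (M : nat) (B : 'I_(ens_size E) -> pred 'I_d) (t tau : R) :
  0 < t -> 0 <= tau -> (forall s, (#|B s| <= M)%N) ->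
  \sum_s ens_prob E s * (\sum_(x | B s x) ens_diag E s x) <=
  \sum_(x | tau < diagp (ens_density E) x) diagp (ens_density E) x
    + M%:R * t + 3 * tau / t.
Proof.
move=> t0 tau0 hB; have [P0 P1] := probvec_diagp hs.
set P := diagp _.
(* Points with P above [tau] are counted in full. At the others Q <= t + Q^2 / t, with [t] charged
   at most [M] times. *)
apply: (@le_trans _ _ (\sum_s ens_prob E s *
   (\sum_(x | tau < P x) ens_diag E s x + M%:R * t
    + \sum_(x | ~~ (tau < P x)) ens_diag E s x ^+ 2 / t))).
  apply: ler_sum => s _; rewrite ler_wpM2l ?(ltW (ens_prob_gt0 s)) //.
  apply: (@le_trans _ _ (\sum_(x | tau < P x) ens_diag E s x
    + \sum_(x | B s x) t
    + \sum_(x | ~~ (tau < P x)) ens_diag E s x ^+ 2 / t)); last first.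
    rewrite lerD2r lerD2l sumr_const -[leLHS]mulr_natl.
    by rewrite ler_wpM2r ?(ltW t0) // ler_nat.
  rewrite addrAC; rewrite [X in X + _ + _]big_mkcond.
  rewrite [X in _ + X + _]big_mkcond [X in _ <= _ + X]big_mkcond.
  rewrite [leLHS]big_mkcond /= -!big_split /=.
  apply: ler_sum => x _; have q0 := ens_diag_ge0 s x.
  have qt : 0 <= ens_diag E s x ^+ 2 / t.
    by rewrite divr_ge0 ?sqr_ge0 ?(ltW t0).
  have qle : ens_diag E s x <= ens_diag E s x ^+ 2 / t + t.
    have e : ens_diag E s x ^+ 2 / t * t = ens_diag E s x ^+ 2.
      by rewrite divfK ?gt_eqF.
    rewrite -(ler_pM2r t0) [leRHS]mulrDl e.
    have := sqr_ge0 (ens_diag E s x - t); nra.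
  case: (B s x); case: (tau < P x) => /=; lra.
rewrite (eq_bigr (fun s => ens_prob E s * (\sum_(x | tau < P x) ens_diag E s x)
  + ens_prob E s * (M%:R * t)
  + ens_prob E s * \sum_(x | ~~ (tau < P x)) ens_diag E s x ^+ 2 / t));
  last by move=> s _; ring.
rewrite !big_split /= ens_exchange -mulr_suml ens_prob_sum mul1r lerD2l.
under eq_bigr do rewrite mulr_sumr.
rewrite exchange_big /=.
(* Where P <= tau, the second moment 3 P^2 is at most 3 tau P. *)
apply: (@le_trans _ _ (\sum_(x | ~~ (tau < P x)) P x * (3 * tau / t))).
  apply: ler_sum => x; rewrite -leNgt => Px.
  under eq_bigr do rewrite mulrA.
  rewrite -mulr_suml mulrA ler_wpM2r ?invr_ge0 ?(ltW t0) //.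
  apply: le_trans (hm x) _; rewrite -/P.
  have := P0 x; rewrite -/P; nra.
rewrite -mulr_suml -[leRHS]mul1r ler_wpM2r //.
  by rewrite divr_ge0 ?mulr_ge0 ?(ltW t0).
rewrite -P1 [leRHS](bigID (fun x => tau < P x)) /= lerDr.
by apply: sumr_ge0 => x _; apply: P0.
Qed.

End SecondMoment.

Section OneShot.
Variables (R : realType) (d : nat).
Implicit Types (E : ensemble R d) (sigma : 'M[R[i]]_d).

Let ln2_gt0 : 0 < ln 2 :> R.
Proof. by rewrite ln_gt0 ?ltr1n. Qed.

(** The deviation sqrt((v + 1) / c) makes the Chebyshev tail at most [c]; the + 1 keeps it positive
    when [v] is 0. *)
Lemma tail_scale (v c : R) : 0 <= v -> 0 < c ->
  0 < Num.sqrt ((v + 1) / c) /\ v / Num.sqrt ((v + 1) / c) ^+ 2 <= c.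
Proof.
move=> v0 c0; have p : 0 < (v + 1) / c by rewrite divr_gt0 // ltr_wpDl.
split; first by rewrite sqrtr_gt0.
rewrite sqr_sqrtr ?(ltW p) // ler_pdivrMr // mulrCA divff ?gt_eqF // mulr1.
by rewrite lerDl.
Qed.

(** Let [T] be the set where P >= e^-(H + s): it has at most e^(H + s) points and misses mass at
    most (1 - eps) / 4. Then 1 - eps <= 2 (|T| / M + (1 - eps) / 4) leaves |T| / M >= (1 - eps) /
    4. *)
Lemma log2_distill_le E (eps : R) M : density (ens_density E) -> eps < 1 ->
  (0 < M)%N -> 1 - eps <= distill_fidelity2 E M ->
  log2 M%:R <= (shannon (diagp (ens_density E))
    + Num.sqrt ((varentropy (diagp (ens_density E)) + 1) / ((1 - eps) / 4))
    + ln (4 / (1 - eps))) / ln 2.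
Proof.
move=> hs e1 M0 hM; set P := diagp _.
have hP : probvec P by apply: probvec_diagp.
set s := Num.sqrt _; have c0 : 0 < (1 - eps) / 4.
  by rewrite divr_gt0 ?subr_gt0 ?ltr0n.
have [s0 sV] : 0 < s /\ varentropy P / s ^+ 2 <= (1 - eps) / 4.
  exact: tail_scale (varentropy_ge0 hP) c0.
rewrite ler_pM2r ?invr_gt0 //.
pose T := [pred x | ~~ (P x < expR (- (shannon P + s)))].
have hT := card_gt_mass hP (expR_gt0 (- (shannon P + s))) (A := T).
have {}hT : #|T|%:R <= expR (shannon P + s).
  by rewrite -[_ + s]opprK expRN; apply: hT => x /=; rewrite -leNgt.
have := distill_fidelity2_le T M0 hP.1; rewrite -/P => le.
have tl := shannon_lower_tail hP s0.
rewrite (eq_bigl (fun x => P x < expR (- (shannon P + s)))) in le; last first.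
  by move=> x /=; rewrite negbK.
have Mp : 0 < M%:R :> R by rewrite ltr0n.
have key : (1 - eps) / 4 <= #|T|%:R / M%:R by lra.
have {}key : M%:R <= expR (shannon P + s) * (4 / (1 - eps)).
  rewrite ler_pdivlMr // in key.
  rewrite -(ler_pM2l c0); apply: le_trans (le_trans key hT) _.
  rewrite mulrCA (_ : _ / 4 * _ = 1) ?mulr1 //.
  by field; rewrite gt_eqF // subr_gt0.
have f0 : 0 < 4 / (1 - eps) by rewrite divr_gt0 ?subr_gt0.
rewrite -[_ + s]expRK -lnM ?posrE ?expR_gt0 // ler_ln ?posrE //.
by rewrite mulr_gt0 ?expR_gt0.
Qed.

Let bound_ge0 sigma (eps : R) : density sigma -> 0 < eps -> eps < 1 ->
  0 <= (shannon (diagp sigma)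
    + Num.sqrt ((varentropy (diagp sigma) + 1) / ((1 - eps) / 4))
    + ln (4 / (1 - eps))) / ln 2.
Proof.
move=> hs e0 e1; rewrite divr_ge0 ?(ltW ln2_gt0) // !addr_ge0 ?sqrtr_ge0 //.
  exact/shannon_ge0/probvec_diagp.
rewrite ln_ge0 // ler_pdivlMr ?subr_gt0 //; lra.
Qed.

Lemma C_c_le E (eps : R) : density (ens_density E) -> 0 < eps -> eps < 1 ->
  C_c E eps <= (shannon (diagp (ens_density E))
    + Num.sqrt ((varentropy (diagp (ens_density E)) + 1) / ((1 - eps) / 4))
    + ln (4 / (1 - eps))) / ln 2.
Proof.
move=> hs e0 e1; apply: sup_le_ge0; first exact: bound_ge0.
by move=> x [M [M0 hM ->]]; apply: log2_distill_le.
Qed.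

Lemma log2_le_C_c E (eps : R) M : density (ens_density E) ->
  eps < 1 -> (0 < M)%N -> 1 - eps <= distill_fidelity2 E M ->
  log2 M%:R <= C_c E eps.
Proof.
move=> hs e1 M0 hM; apply: ub_le_sup; last by exists M.
exists ((shannon (diagp (ens_density E))
    + Num.sqrt ((varentropy (diagp (ens_density E)) + 1) / ((1 - eps) / 4))
    + ln (4 / (1 - eps))) / ln 2).
by move=> x [M' [M0' hM' ->]]; apply: log2_distill_le.
Qed.

Lemma C_c_ge0 E (eps : R) : density (ens_density E) -> eps < 1 ->
  0 <= C_c E eps.
Proof.
move=> hs e1; rewrite /C_c; set S := mkset _.
have [->|/set0P [x [M [M0 hM _]]]] := eqVneq S set0; first by rewrite sup0.
apply: le_trans (log2_le_C_c hs e1 M0 hM).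
by rewrite divr_ge0 ?(ltW ln2_gt0) // ln_ge0 // ler1n.
Qed.

(** The error eps is split into three parts [eta], one for each term of [mean_mass_le]. With t = eta
    / M the last term is at most [eta] as soon as M <= Y = eta^2 / (3 tau), so [M] is the integer
    part of [Y]. *)
Lemma C_c_ge E (eps : R) : density (ens_density E) ->
  (forall x, \sum_s ens_prob E s * ens_diag E s x ^+ 2
     <= 3 * diagp (ens_density E) x ^+ 2) ->
  0 < eps -> eps < 1 ->
  (shannon (diagp (ens_density E))
    - Num.sqrt ((varentropy (diagp (ens_density E)) + 1) / (eps / 3))
    - ln (6 / (eps / 3) ^+ 2)) / ln 2 <= C_c E eps.
Proof.
move=> hs hm e0 e1; set P := diagp _.
have hP : probvec P by apply: probvec_diagp.
set eta := eps / 3; have eta0 : 0 < eta by rewrite divr_gt0 ?ltr0n.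
set s := Num.sqrt _.
have [s0 sV] : 0 < s /\ varentropy P / s ^+ 2 <= eta.
  exact: tail_scale (varentropy_ge0 hP) eta0.
set tau := expR (s - shannon P); have tau0 : 0 < tau by apply: expR_gt0.
set Y := eta ^+ 2 / (3 * tau).
have Y0 : 0 < Y by rewrite divr_gt0 ?exprn_gt0 ?mulr_gt0.
have eq : shannon P - s - ln (6 / eta ^+ 2) = ln (Y / 2).
  rewrite -[shannon P - s]expRK -ln_div ?posrE ?expR_gt0 //; last first.
    by rewrite divr_gt0 ?exprn_gt0.
  rewrite -opprB expRN -/tau; congr ln; rewrite /Y; field.
  by rewrite !gt_eqF.
(* If Y < 1 no positive [M] fits, but then the lower bound ln(Y / 2) is at most 0. *)
rewrite eq ler_pdivrMr //; have [Y1|Y1] := ltP Y 1.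
  apply: (@le_trans _ _ 0); first by apply: ln_le0; lra.
  by rewrite mulr_ge0 ?(ltW ln2_gt0) ?C_c_ge0.
pose M := Num.truncn Y.
have [MY YM] : M%:R <= Y /\ Y < M.+1%:R.
  by have := truncn_itv (ltW Y0) => /andP.
have M0 : (0 < M)%N by rewrite truncn_gt0.
have Mp : 0 < M%:R :> R by rewrite ltr0n.
have [B [hB le]] := distill_fidelity2_ge E M0.
have hd : 1 - eps <= distill_fidelity2 E M.
  apply: le_trans le; rewrite lerD2l lerN2.
  have t0 : 0 < eta / M%:R by rewrite divr_gt0.
  apply: le_trans (mean_mass_le hs hm t0 (ltW tau0) hB) _; rewrite -/P.
  have a1 := le_trans (shannon_upper_tail hP s0) sV.
  have a2 : M%:R * (eta / M%:R) = eta by rewrite mulrC divfK ?gt_eqF.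
  have a3 : 3 * tau / (eta / M%:R) <= eta.
    rewrite ler_pdivrMr // mulrA ler_pdivlMr // -expr2.
    by move: MY; rewrite ler_pdivlMr ?mulr_gt0 // mulrC.
  rewrite a2 (_ : eps = eta + eta + eta); last by rewrite /eta; field.
  by rewrite !lerD.
apply: (@le_trans _ _ (log2 M%:R * ln 2)); last first.
  by rewrite ler_wpM2r ?(ltW ln2_gt0) ?log2_le_C_c.
have Y2 : 0 < Y / 2 by apply: divr_gt0.
rewrite /log2 divfK ?gt_eqF // ler_ln ?posrE //.
(* Y < M + 1 <= 2 M because M >= 1; this is the loss of the factor 2 in [Y / 2]. *)
rewrite ler_pdivrMr // -natrM; apply/ltW/(lt_le_trans YM).
by rewrite ler_nat muln2 -addnn -addn1 leq_add2l.
Qed.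

Lemma C_a_bounds sigma (eps : R) : density sigma -> 0 < eps -> eps < 1 ->
  (shannon (diagp sigma)
    - Num.sqrt ((varentropy (diagp sigma) + 1) / (eps / 3))
    - ln (6 / (eps / 3) ^+ 2)) / ln 2 <= C_a sigma eps <=
  (shannon (diagp sigma)
    + Num.sqrt ((varentropy (diagp sigma) + 1) / ((1 - eps) / 4))
    + ln (4 / (1 - eps))) / ln 2.
Proof.
move=> hs e0 e1; set ub := (X in _ <= _ <= X).
have hub : ubound [set C_c E eps | E in
    [set E : ensemble R d | ens_density E = sigma]] ub.
  by move=> x [E /= hE <-]; have := @C_c_le E eps; rewrite hE; apply.
apply/andP; split; last first.
  by apply: sup_le_ge0 => //; apply: bound_ge0.
have hE := sign_ensemble_density hs.
apply: (@le_trans _ _ (C_c (sign_ensemble hs) eps)).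
  have := @C_c_ge (sign_ensemble hs) eps; rewrite hE; apply=> // x.
  exact: sign_ensemble_moment.
by apply: ub_le_sup; [exists ub | exists (sign_ensemble hs)].
Qed.

Lemma D_a_bounds sigma : density sigma ->
  (shannon (diagp sigma) - ln 3) / ln 2 <= D_a sigma <=
  shannon (diagp sigma) / ln 2.
Proof.
move=> hs; set ub := (X in _ <= _ <= X).
have hub : ubound [set \sum_i ens_prob E i *
      entropy (dephase (ketbra (ens_ket E i))) | E in
    [set E : ensemble R d | ens_density E = sigma]] ub.
  by move=> x [E /= hE <-]; have := @mean_entropy_le _ _ E; rewrite hE; apply.
apply/andP; split; last first.
  apply: sup_le_ge0 => //; rewrite divr_ge0 ?(ltW ln2_gt0) //.
  exact/shannon_ge0/probvec_diagp.
have hE := sign_ensemble_density hs.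
set y := \sum_i ens_prob (sign_ensemble hs) i *
      entropy (dephase (ketbra (ens_ket (sign_ensemble hs) i))).
apply: (@le_trans _ _ y).
  have := @mean_entropy_ge _ _ (sign_ensemble hs); rewrite hE; apply=> // x.
  exact: sign_ensemble_moment.
by apply: ub_le_sup; [exists ub | exists (sign_ensemble hs)].
Qed.

End OneShot.

(** * Asymptotics *)

Section Tensor.
Variable R : realType.

Lemma psdmx_gram m n (C : 'M[R[i]]_(m, n)) : psdmx (C *m adjmx C).
Proof.
split; first by apply/hermP; rewrite adjmxM adjmxK.
move=> v; have := mul_adjmx11 (adjmx v *m C).
rewrite adjmxM adjmxK !mulmxA => ->; rewrite mxE mulr1n ler0c.
by apply: sumr_ge0 => x _; apply: nsq_ge0.
Qed.

(** With A and B factored through [C] and [D], the tensor product is the Gram matrix of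
    [tensmx C D], hence positive. *)
Lemma density_tens m n (A : 'M[R[i]]_m) (B : 'M[R[i]]_n) :
  density A -> density B -> density (tensmx A B).
Proof.
move=> hA hB; have [C hC] := density_factor hA.
have [D hD] := density_factor hB.
split.
  rewrite -hC -hD -tensmx_mul.
  rewrite (_ : tensmx (adjmx C) (adjmx D) = adjmx (tensmx C D)).
    exact: psdmx_gram.
  by apply/matrixP => i j; rewrite !mxE rmorphM.
rewrite -[RHS]mul1r -{1}hA.2 -hB.2 /mxtrace mulr_sum.
by apply: eq_bigr => k _; rewrite !mxE.
Qed.

Lemma diagp_tens m n (A : 'M[R[i]]_m) (B : 'M[R[i]]_n) :
  density A -> density B ->
  diagp (tensmx A B) = tensp (diagp A) (diagp B).
Proof.
move=> hA hB; apply/funext => k; rewrite /diagp mxE !density_diagE //.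
by rewrite -rmorphM.
Qed.

Variables (d : nat) (rho : 'M[R[i]]_d).
Hypothesis hrho : density rho.

Lemma ntensmx_density_entropies n : [/\ density (ntensmx rho n.+1),
  shannon (diagp (ntensmx rho n.+1)) = n.+1%:R * shannon (diagp rho)
  & varentropy (diagp (ntensmx rho n.+1)) = n.+1%:R * varentropy (diagp rho)].
Proof.
elim: n => [|n [hd hS hV]]; first by rewrite !ntensmx1 !mul1r.
have hp := probvec_diagp hrho; have hpn := probvec_diagp hd.
rewrite ntensmxSS; split; first exact: density_tens.
  by rewrite diagp_tens // shannon_tens // hS -[in RHS]natr1 mulrDl mul1r addrC.
rewrite diagp_tens // varentropy_tens // hV.
by rewrite -[in RHS]natr1 mulrDl mul1r addrC.
Qed.

End Tensor.

(** After division by n the error is at most (a + b) / sqrt n, because a / n <= a / sqrt n. *)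
Lemma rate_cvg (R : realType) (x : nat -> R) (h a b : R) : 0 <= a ->
  (forall n, `|x n.+1 - n.+1%:R * h| <= a + b * Num.sqrt n.+1%:R) ->
  (fun n => n%:R^-1 * x n) @ \oo --> h.
Proof.
move=> a0 hx; rewrite -cvg_shiftS /=.
pose r (n : nat) : R := Num.sqrt n.+1%:R^-1.
have r0 : r @ \oo --> (0 : R).
  rewrite -[X in _ --> X](@sqrtr0 R).
  by apply: continuous_cvg; [exact: sqrt_continuous | exact: cvg_harmonic].
have lim c : (fun n => h + c * r n) @ \oo --> h.
  rewrite -[X in _ --> X]addr0 -(mulr0 c).
  by apply: cvgD; [exact: cvg_cst | apply: cvgM => //; exact: cvg_cst].
apply: (squeeze_cvgr _ (lim (- (a + b))) (lim (a + b))).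
near=> n; have := hx n; set N : R := n.+1%:R => hxn.
have N0 : 0 < N by rewrite ltr0n.
have rN : r n * Num.sqrt N = 1.
  by rewrite /r -sqrtrM ?invr_ge0 ?(ltW N0) // mulVf ?gt_eqF // sqrtr1.
have r2 : N^-1 = r n ^+ 2 by rewrite sqr_sqrtr // invr_ge0 ltW.
have rn0 : 0 <= r n by apply: sqrtr_ge0.
have r1 : r n <= 1.
  by rewrite -(@sqrtr1 R); apply: ler_wsqrtr; rewrite invf_le1 // ler1n.
have key : `|N^-1 * x n.+1 - h| <= (a + b) * r n.
  have -> : N^-1 * x n.+1 - h = N^-1 * (x n.+1 - N * h).
    by rewrite mulrBr mulKf ?gt_eqF.
  rewrite normrM ger0_norm ?invr_ge0 ?(ltW N0) //.
  apply: le_trans (ler_wpM2l _ hxn) _; first by rewrite invr_ge0 ltW.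
  rewrite r2 mulrDr (_ : r n ^+ 2 * (b * Num.sqrt N) = b * r n).
    rewrite mulrDl lerD2r mulrC ler_wpM2l // expr2 ler_piMr //.
  by rewrite -[RHS]mulr1 -rN; ring.
move: key; rewrite ler_norml => /andP[k1 k2].
apply/andP; split; [rewrite mulNr -lerBrDl; exact: k1|].
by rewrite -lerBlDl; exact: k2.
Unshelve. all: by end_near.
Qed.

Section Asymptotics.
Variables (R : realType) (d : nat) (rho : 'M[R[i]]_d).
Hypothesis hrho : density rho.

Let h := shannon (diagp rho).
Let v := varentropy (diagp rho).

Let ln2_gt0 : 0 < ln 2 :> R.
Proof. by rewrite ln_gt0 ?ltr1n. Qed.

(** Additivity of the varentropy makes the Chebyshev deviation grow like sqrt n, since n v + 1 <= n
    (v + 1). *)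
Lemma sqrt_affine_le (k : R) n : 0 < k ->
  Num.sqrt ((n.+1%:R * v + 1) / k) <=
  Num.sqrt ((v + 1) / k) * Num.sqrt n.+1%:R.
Proof.
move=> k0; have v0 : 0 <= v by apply/varentropy_ge0/probvec_diagp.
rewrite -sqrtrM; last by rewrite divr_ge0 ?(ltW k0) // addr_ge0.
apply: ler_wsqrtr; rewrite mulrAC ler_wpM2r ?invr_ge0 ?(ltW k0) //.
by rewrite mulrDl mul1r mulrC lerD2l ler1n.
Qed.

Lemma D_a_rate_cvg : D_a_rate rho @ \oo --> h / ln 2.
Proof.
apply: (@rate_cvg _ _ _ (ln 3 / ln 2) 0).
  by rewrite divr_ge0 ?ln_ge0 ?ler1n.
move=> n; have [hd hS _] := ntensmx_density_entropies hrho n.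
have /andP[] := D_a_bounds hd; rewrite hS -/h => l u.
rewrite mul0r addr0 ler_norml mulrA; apply/andP; split; last first.
  apply: le_trans (_ : 0 <= _); first by rewrite subr_le0.
  by rewrite divr_ge0 ?ln_ge0 ?ler1n.
move: l; rewrite mulrBl; lra.
Qed.

(** [eps] enters only the constants of the O(sqrt n) error, so the limit is the same for every [eps]
    in (0, 1). *)
Lemma C_a_rate_cvg (eps : R) : 0 < eps -> eps < 1 ->
  C_a_rate rho eps @ \oo --> h / ln 2.
Proof.
move=> e0 e1.
have k1 : 0 < eps / 3 by rewrite divr_gt0.
have k2 : 0 < (1 - eps) / 4 by rewrite divr_gt0 ?subr_gt0.
pose c1 := ln (6 / (eps / 3) ^+ 2); pose c2 := ln (4 / (1 - eps)).
pose s1 := Num.sqrt ((v + 1) / (eps / 3)).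
pose s2 := Num.sqrt ((v + 1) / ((1 - eps) / 4)).
have i0 : 0 <= (ln 2)^-1 :> R by rewrite invr_ge0 ltW.
apply: (@rate_cvg _ _ _ ((`|c1| + `|c2|) / ln 2) ((s1 + s2) / ln 2)).
  by rewrite divr_ge0 ?addr_ge0 // ltW.
move=> n; have [hd hS hV] := ntensmx_density_entropies hrho n.
have /andP[] := C_a_bounds hd e0 e1; rewrite hS hV -/h -/v -/c1 -/c2 => l u.
have := sqrt_affine_le n k1; have := sqrt_affine_le n k2; rewrite -/s1 -/s2.
move: l u; set N : R := n.+1%:R; set q1 := Num.sqrt (_ / (eps / 3)).
set q2 := Num.sqrt (_ / ((1 - eps) / 4)); set q := Num.sqrt N => l u le2 le1.
have s10 : 0 <= s1 * q by rewrite mulr_ge0 ?sqrtr_ge0.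
have s20 : 0 <= s2 * q by rewrite mulr_ge0 ?sqrtr_ge0.
rewrite mulrA (mulrAC (s1 + s2)) -mulrDl ler_norml.
have := ler_norm c1; have := ler_norm c2.
have := normr_ge0 c1; have := normr_ge0 c2 => ? ? ? ?.
rewrite lerBlDl lerBrDl -mulNr -!mulrDl; apply/andP; split.
  by apply: le_trans l; rewrite ler_wpM2r //; lra.
by apply: le_trans u _; rewrite ler_wpM2r //; lra.
Qed.

End Asymptotics.

(** Convergence is part of the conclusion because [lim] has a default value on divergent
    families. *)
Theorem theorem3 (R : realType) (d : nat) (rho : 'M[R[i]]_d)
    (hrho : density rho) :
  [/\ cvgn (D_a_rate rho),
      forall eps : R, 0 < eps -> eps < 1 -> cvgn (C_a_rate rho eps),
      cvg (limn (C_a_rate rho eps) @[eps --> 0^'+])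
    & C_a_infty rho = D_a_infty rho].
Proof.
have hD := D_a_rate_cvg hrho.
have lim_C : limn (C_a_rate rho eps) @[eps --> 0^'+] -->
    shannon (diagp rho) / ln 2.
  (* The inner limit is constant for [eps] in (0, 1), so the outer limit is that of an eventually
     constant function. *)
  apply: cvg_near_cst; near=> eps; apply: (cvg_lim (@Rhausdorff R)).
  by apply: C_a_rate_cvg.
split.
- by apply/cvg_ex; eexists; apply: hD.
- by move=> eps e0 e1; apply/cvg_ex; eexists; apply: C_a_rate_cvg.
- by apply/cvg_ex; eexists; apply: lim_C.
rewrite /C_a_infty /D_a_infty (cvg_lim _ lim_C) ?(cvg_lim _ hD) //;
  exact: Rhausdorff.
Unshelve. all: by end_near.
Qed.
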